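(* Work in $\mathrm{GB}$ and let $\mathcal S=\langle\mathbb P,\mathcal G,\mathcal F\rangle$ be a class symmetric system. If $\mathcal S$ is combinatorially pretame and stratified, then $\mathcal S$ is pretame.
   Context: Base theory. $\mathrm{GB}$ is two-sorted Gödel--Bernays set theory without choice (lowercase variables for sets, uppercase for classes): Extensionality, Regularity, Pairing, Union, Infinity, Powerset for sets; Extensionality for classes; every set is a class; Separation ($a\cap A$ is a set for every set $a$ and class $A$); Collection (for every set $a$ and class relation $R$ with $\forall x\in a\,\exists y\,\langle x,y\rangle\in R$ there is a set $b$ with $\forall x\in a\,\exists y\in b\,\langle x,y\rangle\in R$); and class existence axioms equivalent to comprehension for first-order formulas (no class quantifiers; class parameters and atomic formulas $x\in X$, $X=Y$ allowed). A sequence $\langle D_i\mid i\in I\rangle$ of classes always means one coded by the single class $\{\langle i,d\rangle\mid i\in I,\ d\in D_i\}$. Class symmetric system. A triple $\mathcal S=\langle\mathbb P,\mathcal G,\mathcal F\rangle$ where: $\mathbb P=\langle P,\le\rangle$ is a preorder with $P,\le$ classes and weakest element $\mathsf 1$; $\mathcal G$ is a group of automorphisms of $\mathbb P$ parametrized by sets, i.e. there is a class $C_{\mathcal G}\subseteq V\times P^2$ such that for each $a\in\operatorname{dom}C_{\mathcal G}$, $\pi_a=\{\langle p,q\rangle\mid\langle a,p,q\rangle\in C_{\mathcal G}\}$ is an automorphism of $\mathbb P$ and $\mathcal G=\{\pi_a\mid a\in\operatorname{dom}C_{\mathcal G}\}$ is a group; $\mathcal F$ is a normal filter of subgroups of $\mathcal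 G$ with a base parametrized by sets, i.e. there is a class $C_{\mathcal F}\subseteq V\times\operatorname{dom}C_{\mathcal G}$ such that for every $a\in\operatorname{dom}C_{\mathcal F}$, $H_a=\{\pi_d\mid\langle a,d\rangle\in C_{\mathcal F}\}$ is a subgroup of $\mathcal G$; some $H_b$ equals $\mathcal G$; for all $a,b$ in $\operatorname{dom}C_{\mathcal F}$ there is $c$ in it with $H_c\subseteq H_a\cap H_b$; and for all $a\in\operatorname{dom}C_{\mathcal F}$, $d\in\operatorname{dom}C_{\mathcal G}$ there is $c\in\operatorname{dom}C_{\mathcal F}$ with $H_c\subseteq\pi_dH_a\pi_d^{-1}$. $\mathcal F$ consists of all subgroups $H=\{\pi_b\mid b\in C\}$ of $\mathcal G$, $C$ a class, with $H_a\subseteq H$ for some $a\in\operatorname{dom}C_{\mathcal F}$. Names. A $\mathbb P$-name is a set or class of pairs $\langle\dot y,p\rangle$ with (recursively) $\dot y$ a set-size $\mathbb P$-name and $p\in P$. For $\pi\in\mathcal G$, $\pi(\dot x)=\{\langle\pi(\dot y),\pi(p)\rangle\mid\langle\dot y,p\rangle\in\dot x\}$. $\dot x$ is symmetric if $\operatorname{sym}(\dot x)=\{\pi\in\mathcal G\mid\pi(\dot x)=\dot x\}\in\mathcal F$, and hereditarily symmetric (an $\mathcal S$-name) if it is symmetric and recursively every $\dot y\in\operatorname{dom}(\dot x)$ is hereditarily symmetric. $\mathrm{HS}$ is the class of all set-size $\mathcal S$-names. For a set or class $X$ of set-size $\mathbb P$-names, $X^\bullet=\{\langle\dot x,\mathsf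 1\rangle\mid\dot x\in X\}$. Combinatorial pretameness. A sequence $\langle D_i\mid i\in I\rangle$ of subclasses of $P$ is symmetric if $I\subseteq\mathrm{HS}$, $I^\bullet$ is symmetric, and there is $H\in\mathcal F$ with $\pi[D_i]=D_{\pi(i)}$ for all $\pi\in H$, $i\in I$. A class $D\subseteq P$ is predense below $q$ if every $r\le q$ is compatible with some element of $D$. $\mathcal S$ is combinatorially pretame if for every $p\in P$ and every symmetric sequence $\langle D_i\mid i\in I\rangle$ of dense subclasses of $\mathbb P$ with $I$ a set, there are $q\le p$ and a set $\langle d_i\mid i\in I\rangle$ such that for all $i\in I$, $d_i\subseteq D_i$ and $d_i$ is predense below $q$. Stratification. A set $b\subseteq P$ is symmetric if $\{\pi\in\mathcal G\mid\pi[b]=b\}\in\mathcal F$. $\mathcal S$ is stratified if for every set $a\subseteq P$ there is a symmetric set $b\subseteq P$ with $a\subseteq b$. Forcing relations. A forcing relation for atomic formulas (for $\mathcal S$) is a class relation $\Vdash_0$ such that for all $p\in P$, $\dot x,\dot y\in\mathrm{HS}$: (1) $p\Vdash_0\dot x\in\dot y$ iff $\{q\in P\mid\exists\langle\dot z,r\rangle\in\dot y\,(q\le r\wedge q\Vdash_0\dot x=\dot z)\}$ is dense below $p$; (2) $p\Vdash_0\dot x\subseteq\dot y$ iff for every $\langle\dot z,r\rangle\in\dot x$ and every $s\le p,r$ there is $q\le s$ with $q\Vdash_0\dot z\in\dot y$; (3) $p\Vdash_0\dot x=\dot y$ iff $p\Vdash_0\dot x\subseteq\dot y$ and $p\Vdash_0\dot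 y\subseteq\dot x$. It is unique if it exists. $\mathcal S$ admits forcing relations if such a class exists. Then for first-order formulas (set variables assigned elements of $\mathrm{HS}$, class variables assigned class $\mathcal S$-names) define: $p\Vdash_{\mathcal S}\dot x\in\dot y$, $p\Vdash_{\mathcal S}\dot x=\dot y$ as for $\Vdash_0$; $p\Vdash_{\mathcal S}\dot x\in\dot X$ iff $\forall q\le p\,\exists r\le q\,\exists\langle\dot z,s\rangle\in\dot X\,(r\le s\wedge r\Vdash_0\dot x=\dot z)$; $p\Vdash_{\mathcal S}\dot X=\dot Y$ iff $p\Vdash_{\mathcal S}\forall x(x\in\dot X\leftrightarrow x\in\dot Y)$; $p\Vdash_{\mathcal S}\varphi\wedge\psi$ iff both are forced by $p$; $p\Vdash_{\mathcal S}\neg\varphi$ iff no $q\le p$ forces $\varphi$; $p\Vdash_{\mathcal S}\exists z\,\varphi$ iff $\forall q\le p\,\exists r\le q\,\exists\dot z\in\mathrm{HS}\ r\Vdash_{\mathcal S}\varphi(\dot z)$. ($\forall,\to,\leftrightarrow$ are abbreviations via $\neg,\wedge,\exists$.) Pretameness. $\mathcal S$ is pretame if it admits forcing relations and preserves Separation and Collection, i.e. for every class $\mathcal S$-name $\dot\Gamma$: $\mathsf 1\Vdash_{\mathcal S}\forall x\exists y\,(y=x\cap\dot\Gamma)$, and $\mathsf 1\Vdash_{\mathcal S}\forall x\,[(\dot\Gamma\text{ is a relation}\wedge\forall u\in x\,\exists v\,\langle u,v\rangle\in\dot\Gamma)\to\exists y\,\forall u\in x\,\exists v\in y\,\langle 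u,v\rangle\in\dot\Gamma]$.
   Formalization: Automorphisms in G are additionally required to fix the weakest element 1 (automatic for partial orders); otherwise Col(ω,Ord) with two weakest elements swapped by G and F={G} is vacuously combinatorially pretame and stratified but not pretame. *)

(* Defs.v *)
(* "Work in GB" is rendered by quantifying over all two-sorted
   structures satisfying the axioms of GB; every notion below is evaluated
   inside such a structure, so all recursions are internal to it. *)
From Stdlib Require Import Arith ClassicalEpsilon.
Set Implicit Arguments.

Record structure := Structure {
  sets : Type;
  classes : Type;
  mem : sets -> sets -> Prop;
  cmem : sets -> classes -> Prop;
  of_set :> sets -> classes
}.

Arguments mem {_} _ _.
Arguments cmem {_} _ _.

Declare Scope gb_scope.
Notation "x ∈ y" := (mem x y) (at level 70, no associativity) : gb_scope.
Notation "x ∊ X" := (cmem x X) (at level 70, no associativity) : gb_scope.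
Open Scope gb_scope.

(* Formulas of the two-sorted language.  Variables of both sorts are named by natural numbers;
   only set variables are quantified. *)

Inductive fml : Type :=
| FMem (x y : nat)
| FEq (x y : nat)
| FCMem (x X : nat)
| FCEq (X Y : nat)
| FNot (phi : fml)
| FAnd (phi psi : fml)
| FEx (x : nat) (phi : fml).

Definition FAll x phi := FNot (FEx x (FNot phi)).
Definition FImp phi psi := FNot (FAnd phi (FNot psi)).
Definition FOr phi psi := FNot (FAnd (FNot phi) (FNot psi)).
Definition FIff phi psi := FAnd (FImp phi psi) (FImp psi phi).

Definition upd (A : Type) (e : nat -> A) (n : nat) (a : A) : nat -> A :=
  fun m => if Nat.eqb m n then a else e m.

Fixpoint sat (M : structure) (e : nat -> sets M) (c : nat -> classes M)
    (phi : fml) : Prop :=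
  match phi with
  | FMem x y => e x ∈ e y
  | FEq x y => e x = e y
  | FCMem x X => e x ∊ c X
  | FCEq X Y => c X = c Y
  | FNot psi => ~ sat M e c psi
  | FAnd psi chi => sat M e c psi /\ sat M e c chi
  | FEx x psi => exists a, sat M (upd e x a) c psi
  end.

(* Kuratowski pairs, as terms.  [upair] is an unspecified set if the structure
   fails to satisfy Pairing. *)
Definition upair (M : structure) (x y : sets M) : sets M :=
  epsilon (inhabits x) (fun w => forall z, z ∈ w <-> z = x \/ z = y).

Definition opair (M : structure) (x y : sets M) : sets M :=
  upair M (upair M x x) (upair M x y).

Arguments upair {_} _ _.
Arguments opair {_} _ _.
Notation "⟨ x , y ⟩" := (opair x y) (at level 0, x at level 99, y at level 99)
  : gb_scope.

Definition is_relation (M : structure) (R : classes M) : Prop :=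
  forall w, w ∊ R -> exists x y, w = ⟨x, y⟩.
Arguments is_relation {_} _.

Record GB (M : structure) : Prop := {
  gb_extensionality : forall x y : sets M, (forall z, z ∈ x <-> z ∈ y) -> x = y;
  gb_regularity : forall x : sets M, (exists y, y ∈ x) ->
    exists y, y ∈ x /\ forall z, ~ (z ∈ y /\ z ∈ x);
  gb_pairing : forall x y : sets M, exists w, forall z, z ∈ w <-> z = x \/ z = y;
  gb_union : forall x : sets M, exists u,
    forall z, z ∈ u <-> exists y, y ∈ x /\ z ∈ y;
  gb_infinity : exists x : sets M,
    (exists o, o ∈ x /\ forall z, ~ z ∈ o) /\
    (forall y, y ∈ x -> exists s, s ∈ x /\ forall z, z ∈ s <-> z ∈ y \/ z = y);
  gb_powerset : forall x : sets M, exists y,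
    forall z, z ∈ y <-> forall w, w ∈ z -> w ∈ x;
  gb_class_extensionality : forall X Y : classes M,
    (forall z, z ∊ X <-> z ∊ Y) -> X = Y;
  gb_of_set : forall x z : sets M, z ∊ of_set M x <-> z ∈ x;
  gb_separation : forall (a : sets M) (A : classes M), exists b : sets M,
    forall x, x ∈ b <-> x ∈ a /\ x ∊ A;
  gb_collection : forall (a : sets M) (R : classes M), is_relation R ->
    (forall x, x ∈ a -> exists y, ⟨x, y⟩ ∊ R) ->
    exists b : sets M, forall x, x ∈ a -> exists y, y ∈ b /\ ⟨x, y⟩ ∊ R;
  gb_comprehension : forall (phi : fml) (e : nat -> sets M)
      (c : nat -> classes M) (n : nat),
    exists X : classes M, forall x, x ∊ X <-> sat M (upd e n x) c phi
}.

Definition in_dom {M : structure} (C : classes M) (a : sets M) : Prop :=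
  exists y, ⟨a, y⟩ ∊ C.

(* [X] is the [a]-th class of the family coded by [C]. *)
Definition is_section {M : structure} (C : classes M) (a : sets M)
    (X : classes M) : Prop :=
  forall y, y ∊ X <-> ⟨a, y⟩ ∊ C.

Definition is_image {M : structure} (R X Y : classes M) : Prop :=
  forall q, q ∊ Y <-> exists p, p ∊ X /\ ⟨p, q⟩ ∊ R.

Definition is_inverse {M : structure} (R S : classes M) : Prop :=
  forall w, w ∊ S <-> exists p q, ⟨p, q⟩ ∊ R /\ w = ⟨q, p⟩.

(* [T] is the composition "first [R], then [S]". *)
Definition is_comp {M : structure} (R S T : classes M) : Prop :=
  forall w, w ∊ T <->
    exists p q r, ⟨p, q⟩ ∊ R /\ ⟨q, r⟩ ∊ S /\ w = ⟨p, r⟩.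

(* [T] is D R D^{-1}, for a bijection [D]. *)
Definition is_conj {M : structure} (D R T : classes M) : Prop :=
  forall w, w ∊ T <-> exists p q p' q',
    ⟨p, q⟩ ∊ R /\ ⟨p, p'⟩ ∊ D /\ ⟨q, q'⟩ ∊ D /\ w = ⟨p', q'⟩.

Record system_data (M : structure) := SystemData {
  cond : classes M;
  order : classes M;
  one : sets M;
  CG : classes M;
  CF : classes M
}.

Arguments cond {_} _.
Arguments order {_} _.
Arguments one {_} _.
Arguments CG {_} _.
Arguments CF {_} _.

Section System.

Context {M : structure} (S : system_data M).

Definition leq (p q : sets M) : Prop := ⟨p, q⟩ ∊ order S.

Definition is_preorder : Prop :=
  (forall w, w ∊ order S -> exists p q, p ∊ cond S /\ q ∊ cond S /\ w = ⟨p, q⟩)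
  /\ (forall p, p ∊ cond S -> leq p p)
  /\ (forall p q r, leq p q -> leq q r -> leq p r)
  /\ one S ∊ cond S
  /\ (forall p, p ∊ cond S -> leq p (one S)).

(* The weakest element [one S] is part of the structure, so automorphisms fix
   it.  This is automatic for partial orders, but not for preorders. *)
Definition is_automorphism (pi : classes M) : Prop :=
  (forall w, w ∊ pi -> exists p q, p ∊ cond S /\ q ∊ cond S /\ w = ⟨p, q⟩)
  /\ (forall p, p ∊ cond S -> exists q, ⟨p, q⟩ ∊ pi)
  /\ (forall p q q', ⟨p, q⟩ ∊ pi -> ⟨p, q'⟩ ∊ pi -> q = q')
  /\ (forall q, q ∊ cond S -> exists p, ⟨p, q⟩ ∊ pi)
  /\ (forall p p' q, ⟨p, q⟩ ∊ pi -> ⟨p', q⟩ ∊ pi -> p = p')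
  /\ (forall p q p' q', ⟨p, p'⟩ ∊ pi -> ⟨q, q'⟩ ∊ pi -> (leq p q <-> leq p' q'))
  /\ ⟨one S, one S⟩ ∊ pi.

(* Collections of classes such as G, its subgroups, and members of F are
   predicates on classes. *)
Definition in_G (pi : classes M) : Prop :=
  exists a, in_dom (CG S) a /\ is_section (CG S) a pi.

Definition is_identity (i : classes M) : Prop :=
  forall w, w ∊ i <-> exists p, p ∊ cond S /\ w = ⟨p, p⟩.

Definition is_group (H : classes M -> Prop) : Prop :=
  (exists i, is_identity i /\ H i)
  /\ (forall pi sigma, H pi -> H sigma ->
        exists tau, is_comp pi sigma tau /\ H tau)
  /\ (forall pi, H pi -> exists tau, is_inverse pi tau /\ H tau).

Definition is_subgroup (H : classes M -> Prop) : Prop :=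
  (forall pi, H pi -> in_G pi) /\ is_group H.

(* The group H_a of the filter base. *)
Definition in_base (a : sets M) (pi : classes M) : Prop :=
  exists d, ⟨a, d⟩ ∊ CF S /\ is_section (CG S) d pi.

Record class_symmetric_system : Prop := {
  css_preorder : is_preorder;
  css_CG : forall w, w ∊ CG S ->
    exists a p q, p ∊ cond S /\ q ∊ cond S /\ w = ⟨a, ⟨p, q⟩⟩;
  css_automorphism : forall pi, in_G pi -> is_automorphism pi;
  css_group : is_group in_G;
  css_CF : forall w, w ∊ CF S -> exists a d, in_dom (CG S) d /\ w = ⟨a, d⟩;
  css_subgroup : forall a, in_dom (CF S) a -> is_subgroup (in_base a);
  css_whole : exists b, in_dom (CF S) b /\ forall pi, in_base b pi <-> in_G pi;
  css_directed : forall a b, in_dom (CF S) a -> in_dom (CF S) b ->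
    exists c, in_dom (CF S) c /\
      forall pi, in_base c pi -> in_base a pi /\ in_base b pi;
  css_normal : forall a d pi_d, in_dom (CF S) a ->
    in_dom (CG S) d -> is_section (CG S) d pi_d ->
    exists c, in_dom (CF S) c /\
      forall pi, in_base c pi -> exists sigma, in_base a sigma /\ is_conj pi_d sigma pi
}.

Definition in_F (H : classes M -> Prop) : Prop :=
  is_subgroup H
  /\ (exists C : classes M,
        (forall b, b ∊ C -> in_dom (CG S) b) /\
        forall pi, H pi <-> exists b, b ∊ C /\ is_section (CG S) b pi)
  /\ (exists a, in_dom (CF S) a /\ forall pi, in_base a pi -> H pi).

(* Recursion over names is expressed by the existence of a set witnessing all
   steps below the given name; by Regularity this amounts to the recursive
   definition. *)

Definition is_set_name (x : sets M) : Prop :=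
  exists t : sets M, x ∈ t /\
    forall z, z ∈ t -> forall w, w ∈ z ->
      exists y p, y ∈ t /\ p ∊ cond S /\ w = ⟨y, p⟩.

Definition is_name (X : classes M) : Prop :=
  forall w, w ∊ X -> exists y p, is_set_name y /\ p ∊ cond S /\ w = ⟨y, p⟩.

(* [f] is a function, with domain closed under taking names occurring in its
   members, satisfying the recursion x |-> pi(x). *)
Definition is_action_attempt (pi : classes M) (f : sets M) : Prop :=
  (forall w, w ∈ f -> exists x x', w = ⟨x, x'⟩)
  /\ (forall x x1 x2, ⟨x, x1⟩ ∈ f -> ⟨x, x2⟩ ∈ f -> x1 = x2)
  /\ (forall x x', ⟨x, x'⟩ ∈ f ->
        (forall y p, ⟨y, p⟩ ∈ x -> exists y', ⟨y, y'⟩ ∈ f) /\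
        (forall w, w ∈ x' <-> exists y p y' p',
           ⟨y, p⟩ ∈ x /\ ⟨y, y'⟩ ∈ f /\ ⟨p, p'⟩ ∊ pi /\ w = ⟨y', p'⟩)).

(* pi(x) = x' *)
Definition set_action (pi : classes M) (x x' : sets M) : Prop :=
  exists f, is_action_attempt pi f /\ ⟨x, x'⟩ ∈ f.

(* pi(X) = X', for set-size and class-size names alike. *)
Definition action (pi X X' : classes M) : Prop :=
  forall w, w ∊ X' <-> exists y p y' p',
    ⟨y, p⟩ ∊ X /\ set_action pi y y' /\ ⟨p, p'⟩ ∊ pi /\ w = ⟨y', p'⟩.

Definition sym (X : classes M) (pi : classes M) : Prop :=
  in_G pi /\ action pi X X.

Definition is_symmetric_name (X : classes M) : Prop :=
  is_name X /\ in_F (sym X).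

Definition HS (x : sets M) : Prop :=
  exists t : sets M, x ∈ t /\
    forall z, z ∈ t -> is_symmetric_name (of_set M z) /\
      forall y p, ⟨y, p⟩ ∈ z -> y ∈ t.

Definition is_class_S_name (X : classes M) : Prop :=
  is_symmetric_name X /\ forall y p, ⟨y, p⟩ ∊ X -> HS y.

Definition is_bullet (X X' : classes M) : Prop :=
  forall w, w ∊ X' <-> exists x, x ∊ X /\ w = ⟨x, one S⟩.

(* [D] codes a sequence of classes indexed by [I]. *)
Definition codes_sequence (I D : classes M) : Prop :=
  forall w, w ∊ D -> exists i d, i ∊ I /\ w = ⟨i, d⟩.

Definition is_symmetric_sequence (I D : classes M) : Prop :=
  codes_sequence I D
  /\ (forall i d, ⟨i, d⟩ ∊ D -> d ∊ cond S)
  /\ (forall i, i ∊ I -> HS i)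
  /\ (exists I', is_bullet I I' /\ is_symmetric_name I')
  /\ (exists H, in_F H /\
        forall pi i, H pi -> i ∊ I -> exists j, set_action pi i j /\ j ∊ I /\
          forall Di Dj, is_section D i Di -> is_section D j Dj ->
            is_image pi Di Dj).

Definition compatible (p q : sets M) : Prop :=
  exists r, r ∊ cond S /\ leq r p /\ leq r q.

Definition is_dense_class (D : classes M) : Prop :=
  (forall d, d ∊ D -> d ∊ cond S)
  /\ forall p, p ∊ cond S -> exists d, d ∊ D /\ leq d p.

Definition predense_below (D : classes M) (q : sets M) : Prop :=
  (forall d, d ∊ D -> d ∊ cond S)
  /\ forall r, r ∊ cond S -> leq r q -> exists d, d ∊ D /\ compatible r d.

Definition combinatorially_pretame : Prop :=
  forall (p I : sets M) (D : classes M),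
    p ∊ cond S ->
    is_symmetric_sequence (of_set M I) D ->
    (forall i Di, i ∈ I -> is_section D i Di -> is_dense_class Di) ->
    exists q e : sets M,
      leq q p /\ codes_sequence (of_set M I) (of_set M e) /\
      forall i Di di, i ∈ I -> is_section D i Di ->
        is_section (of_set M e) i di ->
        (forall d, d ∊ di -> d ∊ Di) /\ predense_below di q.

Definition is_symmetric_set (b : sets M) : Prop :=
  in_F (fun pi => in_G pi /\ is_image pi (of_set M b) (of_set M b)).

Definition stratified : Prop :=
  forall a : sets M, (forall p, p ∈ a -> p ∊ cond S) ->
    exists b : sets M, (forall p, p ∈ b -> p ∊ cond S) /\
      is_symmetric_set b /\ forall p, p ∈ a -> p ∈ b.

Definition dense_below (D : sets M -> Prop) (p : sets M) : Prop :=
  forall q, leq q p -> exists r, leq r q /\ D r.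

(* The class relation for atomic formulas is given as three classes of triples
   ⟨p, ⟨x, y⟩⟩, one for each of the formulas x ∈ y, x ⊆ y and x = y. *)
Record atomic_relation := AtomicRelation {
  rel_in : classes M;
  rel_sub : classes M;
  rel_eq : classes M
}.

Definition forces_in (A : atomic_relation) p x y := ⟨p, ⟨x, y⟩⟩ ∊ rel_in A.
Definition forces_sub (A : atomic_relation) p x y := ⟨p, ⟨x, y⟩⟩ ∊ rel_sub A.
Definition forces_eq (A : atomic_relation) p x y := ⟨p, ⟨x, y⟩⟩ ∊ rel_eq A.

Definition is_forcing_relation (A : atomic_relation) : Prop :=
  forall p x y, p ∊ cond S -> HS x -> HS y ->
    (forces_in A p x y <->
       dense_below (fun q => exists z r,
         ⟨z, r⟩ ∈ y /\ leq q r /\ forces_eq A q x z) p)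
    /\ (forces_sub A p x y <->
       forall z r, ⟨z, r⟩ ∈ x -> forall s, leq s p -> leq s r ->
         exists q, leq q s /\ forces_in A q z y)
    /\ (forces_eq A p x y <-> forces_sub A p x y /\ forces_sub A p y x).

Definition admits_forcing_relations : Prop :=
  exists A, is_forcing_relation A.

(* The clauses for the connectives, on predicates of conditions. *)
Definition fc_not (F : sets M -> Prop) (p : sets M) : Prop :=
  forall q, leq q p -> ~ F q.
Definition fc_and (F1 F2 : sets M -> Prop) (p : sets M) : Prop :=
  F1 p /\ F2 p.
Definition fc_ex (F : sets M -> sets M -> Prop) (p : sets M) : Prop :=
  forall q, leq q p -> exists r, leq r q /\ exists z, HS z /\ F z r.
Definition fc_all F := fc_not (fc_ex (fun z => fc_not (F z))).
Definition fc_imp F1 F2 := fc_not (fc_and F1 (fc_not F2)).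
Definition fc_iff F1 F2 := fc_and (fc_imp F1 F2) (fc_imp F2 F1).

Definition forces_cmem (A : atomic_relation) (x : sets M) (X : classes M)
    (p : sets M) : Prop :=
  dense_below (fun r => exists z s,
    ⟨z, s⟩ ∊ X /\ leq r s /\ forces_eq A r x z) p.

Definition forces_ceq (A : atomic_relation) (X Y : classes M) :
    sets M -> Prop :=
  fc_all (fun x => fc_iff (forces_cmem A x X) (forces_cmem A x Y)).

Fixpoint forces (A : atomic_relation) (e : nat -> sets M)
    (c : nat -> classes M) (phi : fml) : sets M -> Prop :=
  match phi with
  | FMem x y => fun p => forces_in A p (e x) (e y)
  | FEq x y => fun p => forces_eq A p (e x) (e y)
  | FCMem x X => forces_cmem A (e x) (c X)
  | FCEq X Y => forces_ceq A (c X) (c Y)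
  | FNot psi => fc_not (forces A e c psi)
  | FAnd psi chi => fc_and (forces A e c psi) (forces A e c chi)
  | FEx x psi => fc_ex (fun z => forces A (upd e x z) c psi)
  end.

End System.

(* w = {u, v}; uses the bound variable 9. *)
Definition f_upair (w u v : nat) : fml :=
  FAll 9 (FIff (FMem 9 w) (FOr (FEq 9 u) (FEq 9 v))).

(* w = ⟨u, v⟩; uses the bound variables 8 and 9. *)
Definition f_opair (w u v : nat) : fml :=
  FAll 8 (FIff (FMem 8 w) (FOr (f_upair 8 u u) (f_upair 8 u v))).

(* ⟨u, v⟩ ∈ X; uses the bound variables 7, 8 and 9. *)
Definition f_opair_in (u v X : nat) : fml :=
  FEx 7 (FAnd (f_opair 7 u v) (FCMem 7 X)).

(* Set variables: 0 = x, 1 = y, 2 = u, 3 = v, 4 = z.  Class variable: 0 = Γ. *)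

(* ∀x ∃y (y = x ∩ Γ) *)
Definition f_separation : fml :=
  FAll 0 (FEx 1 (FAll 4 (FIff (FMem 4 1) (FAnd (FMem 4 0) (FCMem 4 0))))).

(* Γ is a relation *)
Definition f_is_relation : fml :=
  FAll 4 (FImp (FCMem 4 0) (FEx 2 (FEx 3 (f_opair 4 2 3)))).

(* ∀x ((Γ is a relation ∧ ∀u∈x ∃v ⟨u,v⟩∈Γ) → ∃y ∀u∈x ∃v∈y ⟨u,v⟩∈Γ) *)
Definition f_collection : fml :=
  FAll 0 (FImp
    (FAnd f_is_relation (FAll 2 (FImp (FMem 2 0) (FEx 3 (f_opair_in 2 3 0)))))
    (FEx 1 (FAll 2 (FImp (FMem 2 0)
      (FEx 3 (FAnd (FMem 3 1) (f_opair_in 2 3 0))))))).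

(* The assignment [e] is irrelevant, as the formulas have no free set
   variables; it exists since the empty name is in HS. *)
Definition pretame {M : structure} (S : system_data M) : Prop :=
  admits_forcing_relations S /\
  forall A : atomic_relation, is_forcing_relation S A ->
    forall (Gamma : classes M) (e : nat -> sets M),
      is_class_S_name S Gamma -> (forall n, HS S (e n)) ->
      forces S A e (fun _ => Gamma) f_separation (one S) /\
      forces S A e (fun _ => Gamma) f_collection (one S).

(* Main.v *)
Require Import Defs.
From Stdlib Require Import Arith Lia Classical ClassicalEpsilon FunctionalExtensionality.

(** Both halves of the theorem come from one use of combinatorial pretameness,
    [predense_decision].  Let x be a hereditarily symmetric name and G(w,d) a
    first-order property of names w and conditions d that passes to stronger d
    and is invariant under a group of the filter base.  For w in dom(x) the
    class of d such that d satisfies G(w,-), or no extension of d does, is dense,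
    and these classes form a symmetric sequence indexed by dom(x).  Hence below
    any condition there are q and a set e of pairs <w,d> with G(w,d) such that
    every r <= q with G(w,r) is compatible with some d with <w,d> in e: below q,
    the class G(w,-) is represented by a set.

    Existence of the forcing relation.  The clauses for atomic formulas amount
    to a recursion for forced equality that refers to class-many conditions, and
    in GB such a recursion need not define a class.  However, forced equality is
    also the greatest relation that satisfies the recursion from left to right,
    and it can be witnessed by sets: x = y is certified at p when p extends some
    d with <d,<x,y>> in a set c of triples each of which has the covering
    property relative to c ([coherent]).  Dense certification is first-order, and
    it satisfies the recursion: from left to right by definition, and from right
    to left because [predense_decision], applied with G(w,d) saying that some
    <u,t> in y has d <= t and w = u certified at d, yields a set of triples from
    which a certificate for x = y is assembled.

    Separation.  To separate x by Gamma, decide w in x /\ w in Gamma for all w in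
    dom(x) by sets of conditions.  Stratification puts these conditions into one
    symmetric set b, and y = {<w,d> : w in dom(x), d in b, d forces both} is a
    name for the intersection.

    Collection.  Decide in the same way whether some v is related to w, and
    collect witnesses v for the conditions so obtained into a set.  By [HS_cover]
    it is contained in a symmetric set of names: with all conditions occurring
    hereditarily in those names in a symmetric set b, the stabilizer of b sends
    a name only to names built from conditions in b, so by induction on names
    and the power set axiom its orbits are sets.

    The remaining parts make this available inside a model of GB.  Since classes
    are given by comprehension for syntactic formulas, every class is introduced
    through the predicate [definable], which [prove_definable] establishes from
    the shape of the proposition. *)

Section ClassForcing.
Context {M : structure} (HGB : GB M).
Implicit Types (x y z w a b : sets M) (X Y : classes M).

(** * Ordered pairs *)

Lemma upair_spec x y z : z ∈ upair x y <-> z = x \/ z = y.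
Proof.
  revert z. exact (epsilon_spec (inhabits x) _ (gb_pairing HGB x y)).
Qed.

Lemma set_ext x y : (forall z, z ∈ x <-> z ∈ y) -> x = y.
Proof. apply (gb_extensionality HGB). Qed.

Lemma upair_inj x y x' y' :
  upair x y = upair x' y' -> (x = x' /\ y = y') \/ (x = y' /\ y = x').
Proof.
  intros H.
  assert (Hs : forall z, (z = x \/ z = y) <-> (z = x' \/ z = y')).
  { intros z. rewrite <- !upair_spec, H. tauto. }
  destruct (proj1 (Hs x) (or_introl eq_refl)), (proj1 (Hs y) (or_intror eq_refl)),
    (proj2 (Hs x') (or_introl eq_refl)), (proj2 (Hs y') (or_intror eq_refl));
    subst; auto.
Qed.

Lemma opair_inj x y x' y' : ⟨x, y⟩ = ⟨x', y'⟩ -> x = x' /\ y = y'.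
Proof.
  intros H. apply upair_inj in H as [[H1 H2]|[H1 H2]];
    apply upair_inj in H1 as [[]|[]]; apply upair_inj in H2 as [[]|[]];
    subst; auto.
Qed.

(** * Definability *)

Fixpoint max_var (phi : fml) : nat :=
  match phi with
  | FMem x y | FEq x y => Nat.max x y
  | FCMem x _ => x
  | FCEq _ _ => 0
  | FNot psi => max_var psi
  | FAnd psi chi => Nat.max (max_var psi) (max_var chi)
  | FEx x psi => Nat.max x (max_var psi)
  end.

Fixpoint rename (k : nat) (f : nat -> nat) (phi : fml) : fml :=
  match phi with
  | FMem x y => FMem (f x) (f y)
  | FEq x y => FEq (f x) (f y)
  | FCMem x X => FCMem (f x) X
  | FCEq X Y => FCEq X Y
  | FNot psi => FNot (rename k f psi)
  | FAnd psi chi => FAnd (rename k f psi) (rename k f chi)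
  | FEx x psi => FEx k (rename (S k) (upd f x k) psi)
  end.

(** Bound variables are renamed to k, k+1, ...; as [k] exceeds all new names of
    the variables of [phi], no variable is captured. *)
Lemma sat_rename c phi : forall k f (e e' : nat -> sets M),
  (forall n, n <= max_var phi -> f n < k /\ e n = e' (f n)) ->
  (sat M e' c (rename k f phi) <-> sat M e c phi).
Proof.
  induction phi as [i j|i j|i X|X Y|psi IH|psi IH1 chi IH2|i psi IH];
    simpl; intros k f e e' H.
  - rewrite (proj2 (H i ltac:(lia))), (proj2 (H j ltac:(lia))). tauto.
  - rewrite (proj2 (H i ltac:(lia))), (proj2 (H j ltac:(lia))). tauto.
  - rewrite (proj2 (H i ltac:(lia))). tauto.
  - tauto.
  - rewrite (IH k f e e' H). tauto.
  - rewrite (IH1 k f e e'), (IH2 k f e e'); [tauto| |];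
      intros n Hn; apply H; lia.
  - assert (E : forall a, sat M (upd e' k a) c (rename (S k) (upd f i k) psi)
        <-> sat M (upd e i a) c psi).
    { intros a. apply IH. intros n Hn. unfold upd.
      destruct (Nat.eqb_spec n i) as [->|Hni].
      - rewrite Nat.eqb_refl. auto.
      - destruct (H n) as [H1 H2]; [lia|].
        destruct (Nat.eqb_spec (f n) k); [lia|auto]. }
    split; intros [a Ha]; exists a; apply E, Ha.
Qed.

Fixpoint rename_classes (f : nat -> nat) (phi : fml) : fml :=
  match phi with
  | FMem x y => FMem x y
  | FEq x y => FEq x y
  | FCMem x X => FCMem x (f X)
  | FCEq X Y => FCEq (f X) (f Y)
  | FNot psi => FNot (rename_classes f psi)
  | FAnd psi chi => FAnd (rename_classes f psi) (rename_classes f chi)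
  | FEx x psi => FEx x (rename_classes f psi)
  end.

Lemma sat_rename_classes f phi : forall (e : nat -> sets M) c c',
  (forall n, c n = c' (f n)) ->
  (sat M e c' (rename_classes f phi) <-> sat M e c phi).
Proof.
  induction phi; simpl; intros e c c' H; rewrite <- ?H; try tauto.
  - rewrite (IHphi e c c' H). tauto.
  - rewrite (IHphi1 e c c' H), (IHphi2 e c c' H). tauto.
  - split; intros [a Ha]; exists a; [rewrite <- IHphi|rewrite IHphi]; eauto.
Qed.

(** The variables of a property are de Bruijn indices into the environment, so
    that quantifying over a set shifts the environment by one ([definable_ex]).
    Parameters are classes only; a set parameter is replaced by the class with
    the same elements ([definable_term_const]). *)
Definition definable (P : (nat -> sets M) -> Prop) : Prop :=
  exists phi c, forall e, sat M e c phi <-> P e.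

Definition scons (a : sets M) (e : nat -> sets M) (n : nat) : sets M :=
  match n with 0 => a | S m => e m end.

Lemma definable_equiv (P Q : (nat -> sets M) -> Prop) :
  (forall e, P e <-> Q e) -> definable P -> definable Q.
Proof.
  intros H (phi & c & Hp). exists phi, c. intros e. rewrite Hp. apply H.
Qed.

Lemma a_class : exists X : classes M, True.
Proof. destruct (gb_infinity HGB) as [x _]. exists (of_set M x). exact I. Qed.

Lemma a_set : exists x : sets M, True.
Proof. destruct (gb_infinity HGB) as [x _]. exists x. exact I. Qed.

(** A proposition about no set variable is true or false, so a fixed formula
    expresses it. *)
Lemma definable_const (P : Prop) : definable (fun _ => P).
Proof.
  destruct a_class as [X _].
  destruct (classic P) as [HP|HP]; [exists (FEq 0 0)|exists (FNot (FEq 0 0))];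
    exists (fun _ => X); simpl; tauto.
Qed.

Lemma definable_not P : definable P -> definable (fun e => ~ P e).
Proof.
  intros (phi & c & H). exists (FNot phi), c. intros e. simpl. rewrite H. tauto.
Qed.

Lemma definable_and P Q : definable P -> definable Q -> definable (fun e => P e /\ Q e).
Proof.
  intros (phi & c & H) (psi & c' & H').
  (* The class parameters of the two formulas are interleaved. *)
  exists (FAnd (rename_classes (fun n => 2 * n) phi)
    (rename_classes (fun n => S (2 * n)) psi)),
    (fun n => if Nat.even n then c (Nat.div2 n) else c' (Nat.div2 n)).
  intros e. cbn [sat].
  rewrite (sat_rename_classes _ phi e c), (sat_rename_classes _ psi e c'), H, H'.
  - tauto.
  - intros n. rewrite Nat.even_succ, Nat.odd_even, Nat.div2_succ_double. reflexivity.
  - intros n. rewrite Nat.even_even, Nat.div2_double. reflexivity.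
Qed.

Lemma definable_imp P Q : definable P -> definable Q -> definable (fun e => P e -> Q e).
Proof.
  intros HP HQ.
  refine (definable_equiv _ _ _ (definable_not _ (definable_and _ _ HP (definable_not _ HQ)))).
  intros e. simpl. tauto.
Qed.

Lemma definable_or P Q : definable P -> definable Q -> definable (fun e => P e \/ Q e).
Proof.
  intros HP HQ. refine (definable_equiv _ _ _ (definable_imp _ _ (definable_not _ HP) HQ)).
  intros e. simpl. tauto.
Qed.

Lemma definable_iff P Q : definable P -> definable Q -> definable (fun e => P e <-> Q e).
Proof. intros HP HQ. apply definable_and; apply definable_imp; assumption. Qed.

Lemma definable_rename P f : definable P -> definable (fun e => P (fun n => e (f n))).
Proof.
  intros (phi & c & H).
  assert (Hk : forall m, exists k, forall n, n <= m -> f n < k).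
  { induction m as [|m [k Hk]].
    - exists (S (f 0)). intros n Hn. replace n with 0 by lia. lia.
    - exists (S (k + f (S m))). intros n Hn.
      destruct (Nat.eq_dec n (S m)) as [->|]; [lia|].
      specialize (Hk n ltac:(lia)). lia. }
  destruct (Hk (max_var phi)) as [k Hk'].
  exists (rename k f phi), c. intros e. rewrite <- H.
  apply sat_rename. auto.
Qed.

(** The new bound variable [N] does not occur in the formula; index 0 is renamed
    to it and all other indices move down by one. *)
Lemma definable_ex (P : (nat -> sets M) -> sets M -> Prop) :
  definable (fun e => P (fun n => e (S n)) (e 0)) -> definable (fun e => exists x, P e x).
Proof.
  intros (phi & c & H). set (N := S (max_var phi)).
  exists (FEx N (rename (S N) (fun n => match n with 0 => N | S m => m end) phi)), c.
  intros e. simpl.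
  assert (E : forall a, sat M (upd e N a) c
    (rename (S N) (fun n => match n with 0 => N | S m => m end) phi) <-> P e a).
  { intros a. rewrite (sat_rename c phi _ _ (scons a e)).
    - rewrite (H (scons a e)). simpl. tauto.
    - intros n Hn. destruct n as [|n]; unfold upd; simpl.
      + rewrite Nat.eqb_refl. split; [lia|reflexivity].
      + destruct (Nat.eqb_spec n N); [lia|]. split; [lia|reflexivity]. }
  split; intros [a Ha]; exists a; apply E, Ha.
Qed.

Lemma definable_all (P : (nat -> sets M) -> sets M -> Prop) :
  definable (fun e => P (fun n => e (S n)) (e 0)) -> definable (fun e => forall x, P e x).
Proof.
  intros H.
  refine (definable_equiv _ _ _
    (definable_not _ (definable_ex (fun e x => ~ P e x) (definable_not _ H)))).
  intros e. simpl. split; [|intros H' [x Hx]; exact (Hx (H' x))].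
  intros Hn x. apply NNPP. eauto.
Qed.

Definition definable_term (t : (nat -> sets M) -> sets M) : Prop :=
  definable (fun e => e 0 = t (fun n => e (S n))).

Lemma definable_term_subst t P :
  definable_term t -> definable (fun e => P (fun n => e (S n)) (e 0)) ->
  definable (fun e => P e (t e)).
Proof.
  intros Ht HP.
  refine (definable_equiv _ _ _
    (definable_ex (fun e x => x = t e /\ P e x) (definable_and _ _ Ht HP))).
  intros e. split; [intros (x & -> & H); exact H|eauto].
Qed.

Lemma definable_term_subst2 t1 t2 P :
  definable_term t1 -> definable_term t2 -> definable (fun e => P (e 1) (e 0)) ->
  definable (fun e => P (t1 e) (t2 e)).
Proof.
  intros H1 H2 HP. apply (definable_term_subst t1 (fun e x => P x (t2 e)) H1).
  apply (definable_term_subst (fun e => t2 (fun n => e (S n))) (fun e x => P (e 0) x)).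
  - apply (definable_rename _ (fun n => match n with 0 => 0 | S m => S (S m) end)) in H2.
    exact H2.
  - exact HP.
Qed.

Lemma definable_mem t1 t2 :
  definable_term t1 -> definable_term t2 -> definable (fun e => t1 e ∈ t2 e).
Proof.
  intros H1 H2. apply (definable_term_subst2 _ _ _ H1 H2).
  destruct a_class as [X _]. exists (FMem 1 0), (fun _ => X). reflexivity.
Qed.

Lemma definable_eq t1 t2 :
  definable_term t1 -> definable_term t2 -> definable (fun e => t1 e = t2 e).
Proof.
  intros H1 H2. apply (definable_term_subst2 _ _ _ H1 H2).
  destruct a_class as [X _]. exists (FEq 1 0), (fun _ => X). reflexivity.
Qed.

Lemma definable_cmem t X : definable_term t -> definable (fun e => t e ∊ X).
Proof.
  intros H. apply (definable_term_subst _ (fun _ x => x ∊ X) H).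
  exists (FCMem 0 0), (fun _ => X). reflexivity.
Qed.

Lemma definable_term_var i : definable_term (fun e => e i).
Proof.
  destruct a_class as [X _]. exists (FEq 0 (S i)), (fun _ => X). reflexivity.
Qed.

Lemma definable_term_const a : definable_term (fun _ => a).
Proof.
  refine (definable_equiv (fun e => forall w, w ∈ e 0 <-> w ∊ of_set M a) _ _ _).
  - intros e. split; [|intros ->; intros; symmetry; apply (gb_of_set HGB)].
    intros H. apply set_ext. intros z. rewrite H. apply (gb_of_set HGB).
  - apply definable_all, definable_iff;
      [apply definable_mem; apply definable_term_var|apply definable_cmem, definable_term_var].
Qed.

Lemma definable_term_upair t1 t2 :
  definable_term t1 -> definable_term t2 -> definable_term (fun e => upair (t1 e) (t2 e)).
Proof.
  intros H1 H2. unfold definable_term.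
  assert (L : forall t, definable_term t -> definable_term (fun e => t (fun n => e (S n)))).
  { intros t Ht.
    apply (definable_rename _ (fun n => match n with 0 => 0 | S m => S (S m) end)) in Ht.
    exact Ht. }
  refine (definable_equiv (fun e => forall w, w ∈ e 0 <->
    w = t1 (fun n => e (S n)) \/ w = t2 (fun n => e (S n))) _ _ _).
  - intros e. split.
    + intros H. apply set_ext. intros z. rewrite H, upair_spec. tauto.
    + intros -> w. apply upair_spec.
  - apply definable_all, definable_iff; [apply definable_mem; apply definable_term_var|].
    apply definable_or; apply definable_eq; try apply definable_term_var;
      [exact (L _ (L _ H1))|exact (L _ (L _ H2))].
Qed.

Lemma definable_term_opair t1 t2 :
  definable_term t1 -> definable_term t2 -> definable_term (fun e => ⟨t1 e, t2 e⟩).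
Proof. intros H1 H2. apply definable_term_upair; apply definable_term_upair; assumption. Qed.

(** Collection asks for a class consisting of pairs only, hence [is_relation] in
    [class_rel]. *)
Definition class_pred (P : sets M -> Prop) : Prop :=
  exists X : classes M, forall x, x ∊ X <-> P x.
Definition class_rel (P : sets M -> sets M -> Prop) : Prop :=
  exists X : classes M, is_relation X /\ forall x y, ⟨x, y⟩ ∊ X <-> P x y.
Definition class_rel3 (P : sets M -> sets M -> sets M -> Prop) : Prop :=
  exists X : classes M, forall x y z, ⟨x, ⟨y, z⟩⟩ ∊ X <-> P x y z.

Lemma class_pred_intro P : definable (fun e => P (e 0)) -> class_pred P.
Proof.
  intros (phi & c & H). destruct a_set as [a _].
  destruct (gb_comprehension HGB phi (fun _ => a) c 0) as [X HX].
  exists X. intros x. rewrite HX, H. unfold upd. simpl. tauto.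
Qed.

Lemma class_rel_intro P : definable (fun e => P (e 0) (e 1)) -> class_rel P.
Proof.
  intros H.
  destruct (class_pred_intro (fun w => exists x y, w = ⟨x, y⟩ /\ P x y)) as [X HX].
  - apply definable_ex, definable_ex, definable_and.
    + apply definable_eq;
        [apply definable_term_var|apply definable_term_opair; apply definable_term_var].
    + apply (definable_rename _ (fun n => match n with 0 => 1 | _ => 0 end)) in H.
      exact H.
  - exists X. split.
    + intros w Hw. apply HX in Hw as (x & y & -> & _). eauto.
    + intros x y. rewrite HX. split; [|eauto].
      intros (x' & y' & E & H'). apply opair_inj in E as [-> ->]. exact H'.
Qed.

Lemma class_rel3_intro P : definable (fun e => P (e 0) (e 1) (e 2)) -> class_rel3 P.
Proof.
  intros H.
  destruct (class_pred_intro (fun w => exists x y z, w = ⟨x, ⟨y, z⟩⟩ /\ P x y z))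
    as [X HX].
  - apply definable_ex, definable_ex, definable_ex, definable_and.
    + apply definable_eq; [apply definable_term_var|
        apply definable_term_opair; [|apply definable_term_opair]; apply definable_term_var].
    + apply (definable_rename _ (fun n => match n with 0 => 2 | 1 => 1 | _ => 0 end)) in H.
      exact H.
  - exists X. intros x y z. rewrite HX. split; [|intros H'; exists x, y, z; auto].
    intros (x' & y' & z' & E & H').
    apply opair_inj in E as [-> E]. apply opair_inj in E as [-> ->]. exact H'.
Qed.

Lemma definable_rel1 P t : class_pred P -> definable_term t -> definable (fun e => P (t e)).
Proof.
  intros [X HX] Ht.
  refine (definable_equiv _ _ (fun e => HX (t e)) _). apply definable_cmem, Ht.
Qed.

Lemma definable_rel2 P t1 t2 : class_rel P -> definable_term t1 -> definable_term t2 ->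
  definable (fun e => P (t1 e) (t2 e)).
Proof.
  intros (X & _ & HX) H1 H2.
  refine (definable_equiv _ _ (fun e => HX (t1 e) (t2 e)) _).
  apply definable_cmem, definable_term_opair; assumption.
Qed.

Lemma definable_rel3 P t1 t2 t3 : class_rel3 P ->
  definable_term t1 -> definable_term t2 -> definable_term t3 ->
  definable (fun e => P (t1 e) (t2 e) (t3 e)).
Proof.
  intros [X HX] H1 H2 H3.
  refine (definable_equiv _ _ (fun e => HX (t1 e) (t2 e) (t3 e)) _).
  apply definable_cmem, definable_term_opair; [|apply definable_term_opair]; assumption.
Qed.

Create HintDb gb_class discriminated.

Ltac prove_definable_term :=
  lazymatch goal with
  | |- definable_term (fun _ => ?a) => apply definable_term_const
  | |- definable_term (fun e => e ?i) => apply definable_term_var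
  | |- definable_term (fun e => opair (@?t1 e) (@?t2 e)) =>
      apply (definable_term_opair t1 t2); cbv beta; prove_definable_term
  | |- definable_term (fun e => upair (@?t1 e) (@?t2 e)) =>
      apply (definable_term_upair t1 t2); cbv beta; prove_definable_term
  end.

Create HintDb gb_unfold.

Ltac class_known := solve [assumption | eauto with gb_class nocore].

(** An atom built from a relation that is already known to be a class is
    definable whatever its arguments are; [gb_class] collects these relations. *)
Ltac definable_by_class :=
  match goal with
  | |- definable (fun e => ?R (@?t e) (@?u e) (@?v e)) =>
      apply (definable_rel3 R t u v); [class_known | cbv beta; prove_definable_term ..]
  | |- definable (fun e => ?R (@?t e) (@?u e)) =>
      apply (definable_rel2 R t u); [class_known | cbv beta; prove_definable_term ..]
  | |- definable (fun e => ?R (@?t e)) =>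
      apply (definable_rel1 R t); [class_known | cbv beta; prove_definable_term]
  end.

Ltac prove_definable :=
  cbv beta;
  lazymatch goal with
  | |- definable (fun _ => ?P) => apply definable_const
  | |- definable (fun e => exists x : sets _, @?P e x) =>
      apply (definable_ex P); prove_definable
  | |- definable (fun e => forall x : sets _, @?P e x) =>
      apply (definable_all P); prove_definable
  | |- definable (fun e => ~ @?P e) =>
      apply (definable_not P); prove_definable
  | |- definable (fun e => @?P e /\ @?Q e) =>
      apply (definable_and P Q); prove_definable
  | |- definable (fun e => @?P e \/ @?Q e) =>
      apply (definable_or P Q); prove_definable
  | |- definable (fun e => @?P e <-> @?Q e) =>
      apply (definable_iff P Q); prove_definable
  | |- definable (fun e => @?P e -> @?Q e) =>
      apply (definable_imp P Q); prove_definable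
  | |- definable (fun e => mem (@?t e) (@?u e)) =>
      apply (definable_mem t u); cbv beta; prove_definable_term
  | |- definable (fun e => (@?t e) = (@?u e)) =>
      apply (definable_eq t u); cbv beta; prove_definable_term
  | |- definable (fun e => cmem (@?t e) ?X) =>
      apply (definable_cmem t X); cbv beta; prove_definable_term
  | |- _ =>
      first [ definable_by_class
            | progress autounfold with gb_unfold; prove_definable ]
  end.

(** Turns a first-order definition into a class.  Definitions listed in
    [gb_unfold] are unfolded on the way. *)
Ltac prove_class :=
  first [ apply class_pred_intro
        | apply class_rel_intro
        | apply class_rel3_intro ]; prove_definable.

(** * Set constructions *)

Implicit Types (p q r s t u v d : sets M) (pi sg tau : classes M).

Hint Unfold in_dom leq compatible : gb_unfold.

Lemma separation (P : sets M -> Prop) (a : sets M) :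
  class_pred P -> exists b : sets M, forall x, x ∈ b <-> x ∈ a /\ P x.
Proof.
  intros [X HX]. destruct (gb_separation HGB a X) as [b Hb].
  exists b. intros x. rewrite Hb, HX. tauto.
Qed.

Lemma bounded_set (P : sets M -> Prop) (a : sets M) :
  class_pred P -> (forall x, P x -> x ∈ a) -> exists b : sets M, forall x, x ∈ b <-> P x.
Proof.
  intros HP Ha. destruct (separation P a HP) as [b Hb].
  exists b. intros x. rewrite Hb. firstorder.
Qed.

Lemma collection (R : sets M -> sets M -> Prop) (a : sets M) :
  class_rel R ->
  exists b : sets M, forall x, x ∈ a -> (exists y, R x y) -> exists y, y ∈ b /\ R x y.
Proof.
  intros HR. destruct (separation (fun x => exists y, R x y) a) as [a' Ha'].
  { prove_class. }
  destruct HR as (X & Hrel & HX).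
  destruct (gb_collection HGB a' Hrel) as [b Hb].
  { intros x Hx. apply Ha' in Hx as [_ [y Hy]]. exists y. apply HX, Hy. }
  exists b. intros x Hx Hy. destruct (Hb x) as (y & Hyb & Hxy).
  - apply Ha'. auto.
  - exists y. split; [exact Hyb|apply HX, Hxy].
Qed.

Lemma replacement (R : sets M -> sets M -> Prop) (a : sets M) :
  class_rel R -> (forall x y y', x ∈ a -> R x y -> R x y' -> y = y') ->
  exists b : sets M, forall y, y ∈ b <-> exists x, x ∈ a /\ R x y.
Proof.
  intros HR Hf. destruct (collection R a HR) as [b Hb].
  apply (bounded_set _ b); [prove_class|].
  intros y (x & Hx & Hxy). destruct (Hb x Hx (ex_intro _ y Hxy)) as (y' & Hy' & Hxy').
  rewrite (Hf x y y'); auto.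
Qed.

Lemma union2 (a b : sets M) : exists c : sets M, forall x, x ∈ c <-> x ∈ a \/ x ∈ b.
Proof.
  destruct (gb_union HGB (upair a b)) as [c Hc]. exists c. intros x. rewrite Hc.
  split.
  - intros (y & Hy & Hx). apply (upair_spec) in Hy as [-> | ->]; auto.
  - intros [H|H]; [exists a|exists b]; rewrite (upair_spec); auto.
Qed.

Lemma adjoin (a y : sets M) : exists c : sets M, forall x, x ∈ c <-> x ∈ a \/ x = y.
Proof.
  destruct (union2 a (upair y y)) as [c Hc]. exists c. intros x.
  rewrite Hc, upair_spec. tauto.
Qed.

Lemma opair_members (x y z : sets M) : z ∈ ⟨x, y⟩ <-> z = upair x x \/ z = upair x y.
Proof. apply (upair_spec). Qed.

Lemma product (a b : sets M) : exists c : sets M, forall w,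
  w ∈ c <-> exists x y, x ∈ a /\ y ∈ b /\ w = ⟨x, y⟩.
Proof.
  destruct (union2 a b) as [u Hu].
  destruct (gb_powerset HGB u) as [pu Hpu].
  destruct (gb_powerset HGB pu) as [ppu Hppu].
  apply (bounded_set _ ppu); [prove_class|].
  intros w (x & y & Hx & Hy & ->). apply Hppu. intros v Hv. apply Hpu. intros z Hz.
  apply Hu. apply opair_members in Hv as [-> | ->];
    apply (upair_spec) in Hz as [-> | ->]; auto.
Qed.

Lemma domain (x : sets M) : exists d : sets M, forall y, y ∈ d <-> exists p, ⟨y, p⟩ ∈ x.
Proof.
  destruct (gb_union HGB x) as [u Hu]. destruct (gb_union HGB u) as [uu Huu].
  apply (bounded_set _ uu); [prove_class|].
  intros y [p Hp]. apply Huu. exists (upair y y). split.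
  - apply Hu. exists ⟨y, p⟩. split; [exact Hp|]. apply opair_members. auto.
  - apply (upair_spec). auto.
Qed.

Lemma range (x : sets M) : exists d : sets M, forall p, p ∈ d <-> exists y, ⟨y, p⟩ ∈ x.
Proof.
  destruct (gb_union HGB x) as [u Hu]. destruct (gb_union HGB u) as [uu Huu].
  apply (bounded_set _ uu); [prove_class|].
  intros p [y Hp]. apply Huu. exists (upair y p). split.
  - apply Hu. exists ⟨y, p⟩. split; [exact Hp|]. apply opair_members. auto.
  - apply (upair_spec). auto.
Qed.

(** Regularity, for the descent from x to y with <y,p> in x.  It is applied to
    [t] together with the pairs <y,p> and the singletons {y} between two elements
    of [t], since y is in {y}, {y} in <y,p> and <y,p> in x; this avoids transitive
    closures. *)
Lemma domain_well_founded (t : sets M) :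
  (forall x, x ∈ t -> exists y p, y ∈ t /\ ⟨y, p⟩ ∈ x) -> forall x, ~ x ∈ t.
Proof.
  intros Ht x Hx.
  destruct (gb_union HGB t) as [u Hu]. destruct (gb_union HGB u) as [uu Huu].
  destruct (union2 t u) as [v Hv]. destruct (union2 v uu) as [v' Hv'].
  destruct (bounded_set (fun w => w ∈ t
    \/ (exists z y p, z ∈ t /\ y ∈ t /\ ⟨y, p⟩ ∈ z /\ w = ⟨y, p⟩)
    \/ (exists z y p, z ∈ t /\ y ∈ t /\ ⟨y, p⟩ ∈ z /\ w = upair y y)) v') as [s Hs].
  - prove_class.
  - intros w Hw. rewrite Hv', Hv.
    destruct Hw as [Hw|[(z & y & p & Hz & Hy & Hp & ->)|(z & y & p & Hz & Hy & Hp & ->)]].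
    + auto.
    + left. right. apply Hu. eauto.
    + right. apply Huu. exists ⟨y, p⟩. split; [apply Hu; eauto|].
      apply opair_members. auto.
  - destruct (gb_regularity HGB s) as (m & Hm & Hmin).
    { exists x. apply Hs. auto. }
    apply Hs in Hm as
      [Hw|[(z & y & p & Hz & Hy & Hp & ->)|(z & y & p & Hz & Hy & Hp & ->)]].
    + destruct (Ht m Hw) as (y & p & Hy & Hp).
      apply (Hmin ⟨y, p⟩). split; [exact Hp|]. apply Hs. right. left.
      exists m, y, p. auto.
    + apply (Hmin (upair y y)). split; [apply opair_members; auto|].
      apply Hs. right. right. exists z, y, p. auto.
    + apply (Hmin y). split; [apply (upair_spec); auto|]. apply Hs. auto.
Qed.

(** * Hereditary properties *)

(** The common shape of [is_set_name] and [HS], so that closure and induction are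
    proved for both at once. *)
Definition hereditarily (A : sets M -> Prop) (x : sets M) : Prop :=
  exists t : sets M, x ∈ t /\
    forall z, z ∈ t -> A z /\ forall y p, ⟨y, p⟩ ∈ z -> y ∈ t.

Lemma hereditarily_class A : class_pred A -> class_pred (hereditarily A).
Proof. intros HA. unfold hereditarily. prove_class. Qed.

Lemma hereditarily_elim A x : hereditarily A x ->
  A x /\ forall y p, ⟨y, p⟩ ∈ x -> hereditarily A y.
Proof.
  intros (t & Hx & Ht). split; [apply Ht, Hx|].
  intros y p Hy. exists t. split; [|exact Ht]. exact (proj2 (Ht x Hx) y p Hy).
Qed.

(** Collection gathers witnesses for the elements of [a]; their union is closed
    under passing to the domain. *)
Lemma hereditary_cover A a : class_pred A ->
  exists t : sets M, (forall x, x ∈ a -> hereditarily A x -> x ∈ t) /\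
    forall z, z ∈ t -> A z /\ forall y p, ⟨y, p⟩ ∈ z -> y ∈ t.
Proof.
  intros HA.
  set (R := fun x t : sets M => x ∈ t /\
    forall z, z ∈ t -> A z /\ forall y p, ⟨y, p⟩ ∈ z -> y ∈ t).
  destruct (collection R a) as [b Hb]. { unfold R. prove_class. }
  destruct (separation (fun t => exists x, R x t) b) as [c Hc].
  { unfold R. prove_class. }
  destruct (gb_union HGB c) as [u Hu]. exists u. split.
  - intros x Hx Hh. destruct (Hb x Hx Hh) as (t & Ht & HR).
    apply Hu. exists t. split; [apply Hc; eauto|apply HR].
  - intros z Hz. apply Hu in Hz as (t & Ht & Hzt).
    assert (Ht' := Ht). apply Hc in Ht' as (_ & x & _ & Hcl).
    destruct (Hcl z Hzt) as [H1 H2]. split; [exact H1|].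
    intros y p Hy. apply Hu. eauto.
Qed.

Lemma hereditarily_intro A x : class_pred A -> A x ->
  (forall y p, ⟨y, p⟩ ∈ x -> hereditarily A y) -> hereditarily A x.
Proof.
  intros HA Hx Hdom. destruct (domain x) as [d Hd].
  destruct (hereditary_cover A d HA) as (t & Ht & Hcl).
  destruct (adjoin t x) as [t' Ht']. exists t'. split; [apply Ht'; auto|].
  intros z Hz. apply Ht' in Hz as [Hz| ->].
  - destruct (Hcl z Hz) as [H1 H2]. split; [exact H1|].
    intros y p Hy. apply Ht'. eauto.
  - split; [exact Hx|]. intros y p Hy. apply Ht'. left.
    apply Ht; [apply Hd; eauto|eauto].
Qed.

Lemma hereditarily_ind A P : class_pred P ->
  (forall x, hereditarily A x -> (forall y p, ⟨y, p⟩ ∈ x -> P y) -> P x) ->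
  forall x, hereditarily A x -> P x.
Proof.
  intros HP Hstep x (t & Hx & Ht). apply NNPP. intros Hn.
  destruct (separation (fun z => ~ P z) t) as [s Hs]. { prove_class. }
  apply (domain_well_founded s) with (x := x); [|apply Hs; auto].
  intros z Hz. apply Hs in Hz as [Hz HPz].
  apply NNPP. intros Hno. apply HPz, Hstep.
  - exists t. auto.
  - intros y p Hy. apply NNPP. intros HPy. apply Hno. exists y, p.
    split; [|exact Hy]. apply Hs. split; [|exact HPy].
    exact (proj2 (Ht z Hz) y p Hy).
Qed.

Context (S : system_data M) (hS : class_symmetric_system S).

Notation "p ≼ q" := (leq S p q) (at level 70).

(** * Names and the action of automorphisms *)

Hint Unfold set_action is_action_attempt : gb_unfold.

Definition pairs_with_condition x : Prop :=
  forall w, w ∈ x -> exists y p, w = ⟨y, p⟩ /\ p ∊ cond S.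

Lemma is_set_name_iff x : is_set_name S x <-> hereditarily pairs_with_condition x.
Proof.
  split; intros (t & Hx & Ht); exists t; (split; [exact Hx|]); intros z Hz.
  - split.
    + intros w Hw. destruct (Ht z Hz w Hw) as (y & p & _ & Hp & ->). eauto.
    + intros y p Hy. destruct (Ht z Hz _ Hy) as (y' & p' & Hy' & _ & E).
      apply (opair_inj) in E as [-> _]. exact Hy'.
  - intros w Hw. destruct (Ht z Hz) as [H1 H2].
    destruct (H1 w Hw) as (y & p & -> & Hp). exists y, p. eauto.
Qed.

Lemma is_set_name_class : class_pred (is_set_name S).
Proof. unfold is_set_name. prove_class. Qed.
Hint Resolve is_set_name_class : gb_class.

Lemma pairs_with_condition_class : class_pred pairs_with_condition.
Proof. unfold pairs_with_condition. prove_class. Qed.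

Lemma name_dom x y p : is_set_name S x -> ⟨y, p⟩ ∈ x -> is_set_name S y /\ p ∊ cond S.
Proof.
  intros Hx Hy. apply is_set_name_iff, hereditarily_elim in Hx as [H1 H2]. split.
  - apply is_set_name_iff. eauto.
  - destruct (H1 _ Hy) as (y' & p' & E & Hp).
    apply (opair_inj) in E as [_ ->]. exact Hp.
Qed.

Lemma name_pair x w : is_set_name S x -> w ∈ x -> exists y p,
  w = ⟨y, p⟩ /\ is_set_name S y /\ p ∊ cond S.
Proof.
  intros Hx Hw. assert (H := Hx).
  apply is_set_name_iff, hereditarily_elim in H as [H _].
  destruct (H w Hw) as (y & p & -> & _). exists y, p.
  split; [reflexivity|]. exact (name_dom x y p Hx Hw).
Qed.

Lemma name_intro x :
  (forall w, w ∈ x -> exists y p, w = ⟨y, p⟩ /\ is_set_name S y /\ p ∊ cond S) ->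
  is_set_name S x.
Proof.
  intros H. apply is_set_name_iff, hereditarily_intro; [apply pairs_with_condition_class|..].
  - intros w Hw. destruct (H w Hw) as (y & p & -> & _ & Hp). eauto.
  - intros y p Hy. destruct (H _ Hy) as (y' & p' & E & Hy' & _).
    apply (opair_inj) in E as [-> _]. apply is_set_name_iff, Hy'.
Qed.

Lemma name_ind P : class_pred P ->
  (forall x, is_set_name S x -> (forall y p, ⟨y, p⟩ ∈ x -> P y) -> P x) ->
  forall x, is_set_name S x -> P x.
Proof.
  intros HP Hstep x Hx. apply is_set_name_iff in Hx. revert x Hx.
  apply (hereditarily_ind); [exact HP|].
  intros x Hx. apply Hstep, is_set_name_iff, Hx.
Qed.

Lemma is_name_of_set x : is_name S (of_set M x) <-> is_set_name S x.
Proof.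
  split.
  - intros H. apply name_intro. intros w Hw.
    destruct (H w) as (y & p & Hy & Hp & ->); [apply (gb_of_set HGB), Hw|]. eauto.
  - intros H w Hw. apply (gb_of_set HGB) in Hw.
    destruct (name_pair x w H Hw) as (y & p & -> & Hy & Hp). eauto.
Qed.

Section Action.
Variable pi : classes M.
Hypothesis pi_fun : forall p q q', ⟨p, q⟩ ∊ pi -> ⟨p, q'⟩ ∊ pi -> q = q'.

Lemma set_action_class : class_rel (set_action pi).
Proof. prove_class. Qed.
Hint Resolve set_action_class : gb_class.

(** The set of arguments at which two attempts differ would have, with each x,
    also an element of dom(x). *)
Lemma attempt_unique f1 f2 x x1 x2 :
  is_action_attempt pi f1 -> is_action_attempt pi f2 ->
  ⟨x, x1⟩ ∈ f1 -> ⟨x, x2⟩ ∈ f2 -> x1 = x2.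
Proof.
  intros (Hp1 & Hf1 & H1) (Hp2 & Hf2 & H2) Hx1 Hx2.
  destruct (domain f1) as [d Hd].
  destruct (separation (fun x => exists x1 x2,
    ⟨x, x1⟩ ∈ f1 /\ ⟨x, x2⟩ ∈ f2 /\ x1 <> x2) d) as [t Ht]. { prove_class. }
  apply NNPP. intros Hne.
  apply (domain_well_founded t) with (x := x).
  2: { apply Ht. split; [apply Hd; eauto|]. exists x1, x2. auto. }
  clear x x1 x2 Hx1 Hx2 Hne. intros x Hx.
  apply Ht in Hx as (_ & x1 & x2 & Hx1 & Hx2 & Hne).
  apply NNPP. intros Hno. apply Hne.
  destruct (H1 x x1 Hx1) as [Hc1 Hm1]. destruct (H2 x x2 Hx2) as [Hc2 Hm2].
  assert (E : forall y p y1 y2, ⟨y, p⟩ ∈ x -> ⟨y, y1⟩ ∈ f1 -> ⟨y, y2⟩ ∈ f2 -> y1 = y2).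
  { intros y p y1 y2 Hy Hy1 Hy2. apply NNPP. intros Hne'. apply Hno.
    exists y, p. split; [|exact Hy]. apply Ht. split; [apply Hd; eauto|].
    exists y1, y2. auto. }
  apply (set_ext). intros w. rewrite Hm1, Hm2. split.
  - intros (y & p & y' & p' & Hy & Hyy & Hpp & ->).
    destruct (Hc2 y p Hy) as [y2 Hy2]. rewrite (E y p y' y2 Hy Hyy Hy2).
    exists y, p, y2, p'. auto.
  - intros (y & p & y' & p' & Hy & Hyy & Hpp & ->).
    destruct (Hc1 y p Hy) as [y1 Hy1]. rewrite <- (E y p y1 y' Hy Hy1 Hyy).
    exists y, p, y1, p'. auto.
Qed.

Lemma set_action_fun x x1 x2 :
  set_action pi x x1 -> set_action pi x x2 -> x1 = x2.
Proof.
  intros (f1 & Ha1 & H1) (f2 & Ha2 & H2). exact (attempt_unique f1 f2 x x1 x2 Ha1 Ha2 H1 H2).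
Qed.

Lemma set_action_unfold x x' : set_action pi x x' ->
  forall w, w ∈ x' <-> exists y p y' p',
    ⟨y, p⟩ ∈ x /\ set_action pi y y' /\ ⟨p, p'⟩ ∊ pi /\ w = ⟨y', p'⟩.
Proof.
  intros (f & Hf & Hx) w. assert (Hf' := Hf). destruct Hf' as (_ & _ & H).
  destruct (H x x' Hx) as [Hc Hm]. rewrite Hm. split.
  - intros (y & p & y' & p' & Hy & Hyy & Hpp & ->). exists y, p, y', p'.
    repeat split; auto. exists f. auto.
  - intros (y & p & y' & p' & Hy & Hyy & Hpp & ->).
    destruct (Hc y p Hy) as [y2 Hy2].
    rewrite (set_action_fun y y' y2 Hyy) by (exists f; auto).
    exists y, p, y2, p'. auto.
Qed.

Lemma attempt_union b u : (forall f, f ∈ b -> is_action_attempt pi f) ->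
  (forall w, w ∈ u <-> exists f, f ∈ b /\ w ∈ f) -> is_action_attempt pi u.
Proof.
  intros Hb Hu.
  assert (Hfun : forall x x1 x2, ⟨x, x1⟩ ∈ u -> ⟨x, x2⟩ ∈ u -> x1 = x2).
  { intros x x1 x2 H1 H2. apply Hu in H1 as (f1 & Hf1 & H1).
    apply Hu in H2 as (f2 & Hf2 & H2).
    exact (attempt_unique f1 f2 x x1 x2 (Hb _ Hf1) (Hb _ Hf2) H1 H2). }
  split; [|split; [exact Hfun|]].
  - intros w Hw. apply Hu in Hw as (f & Hf & Hw). exact (proj1 (Hb f Hf) w Hw).
  - intros x x' Hx. apply Hu in Hx as (f & Hf & Hx).
    destruct (proj2 (proj2 (Hb f Hf)) x x' Hx) as [Hc Hm]. split.
    + intros y p Hy. destruct (Hc y p Hy) as [y' Hy']. exists y'. apply Hu. eauto.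
    + intros w. rewrite Hm. split; intros (y & p & y' & p' & Hy & Hyy & Hpp & ->).
      * exists y, p, y', p'. repeat split; auto. apply Hu. eauto.
      * destruct (Hc y p Hy) as [y2 Hy2].
        rewrite (Hfun y y' y2 Hyy) by (apply Hu; eauto).
        exists y, p, y2, p'. auto.
Qed.

(** Recursion on names: by uniqueness the union of attempts for the elements of
    dom(x) is again an attempt, and it is extended by one value at x. *)
Lemma set_action_total x : is_set_name S x -> exists x', set_action pi x x'.
Proof.
  revert x. apply name_ind. { prove_class. }
  intros x Hx IH. destruct (domain x) as [d Hd].
  destruct (collection (fun y f => is_action_attempt pi f /\ exists y', ⟨y, y'⟩ ∈ f) d)
    as [b Hb]. { prove_class. }
  destruct (separation (is_action_attempt pi) b) as [c Hc]. { prove_class. }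
  destruct (gb_union HGB c) as [u Hu].
  assert (Hatt : is_action_attempt pi u).
  { apply (attempt_union c); [|exact Hu]. intros f Hf. apply Hc, Hf. }
  assert (Hdom : forall y p, ⟨y, p⟩ ∈ x -> exists y', ⟨y, y'⟩ ∈ u).
  { intros y p Hy. destruct (IH y p Hy) as (y' & f & Hf & Hyf).
    destruct (Hb y) as (g & Hg & Hg' & z & Hz); [apply Hd; eauto|eauto|].
    exists z. apply Hu. exists g. split; [apply Hc; auto|exact Hz]. }
  destruct (classic (exists x', ⟨x, x'⟩ ∈ u)) as [[x' Hx']|Hno].
  { exists x', u. auto. }
  destruct Hatt as (Hp & Hf & Hr).
  destruct (replacement (fun w v => exists y p y' p',
    w = ⟨y, p⟩ /\ ⟨y, y'⟩ ∈ u /\ ⟨p, p'⟩ ∊ pi /\ v = ⟨y', p'⟩) x) as [x' Hx'].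
  { prove_class. }
  { intros w v v' _ (y & p & y' & p' & -> & H1 & H2 & ->)
      (z & q & z' & q' & E & H3 & H4 & ->).
    apply (opair_inj) in E as [<- <-].
    rewrite (Hf _ _ _ H1 H3), (pi_fun _ _ _ H2 H4). reflexivity. }
  destruct (adjoin u ⟨x, x'⟩) as [g Hg].
  exists x', g. split; [|apply Hg; auto].
  assert (Hold : forall y y', (exists z, ⟨y, z⟩ ∈ u) -> ⟨y, y'⟩ ∈ g -> ⟨y, y'⟩ ∈ u).
  { intros y y' Hz Hy. apply Hg in Hy as [Hy|E]; [exact Hy|].
    apply (opair_inj) in E as [-> _]. contradiction. }
  split; [|split].
  - intros w Hw. apply Hg in Hw as [Hw| ->]; eauto.
  - intros y y1 y2 H1 H2. destruct (classic (exists z, ⟨y, z⟩ ∈ u)) as [Hy|Hy].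
    + apply (Hf y); apply Hold; assumption.
    + apply Hg in H1 as [H1|E1]; [exfalso; eauto|].
      apply Hg in H2 as [H2|E2]; [exfalso; eauto|].
      apply (opair_inj) in E1 as [_ ->], E2 as [_ ->]. reflexivity.
  - intros y y' Hy. apply Hg in Hy as [Hy|E].
    + destruct (Hr y y' Hy) as [Hcl Hm]. split.
      * intros z p Hz. destruct (Hcl z p Hz) as [z' Hz']. exists z'. apply Hg. auto.
      * intros w. rewrite Hm. split; intros (z & p & z' & p' & H1 & H2 & H3 & H4);
          exists z, p, z', p'; repeat split; auto; [apply Hg; auto|apply Hold; eauto].
    + apply (opair_inj) in E as [-> ->]. split.
      * intros z p Hz. destruct (Hdom z p Hz) as [z' Hz']. exists z'. apply Hg. auto.
      * intros w. rewrite Hx'. split.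
        -- intros (v & Hv & z & p & z' & p' & -> & H2 & H3 & H4).
           exists z, p, z', p'. repeat split; auto. apply Hg. auto.
        -- intros (z & p & z' & p' & H1 & H2 & H3 & H4). exists ⟨z, p⟩.
           split; [exact H1|]. exists z, p, z', p'. repeat split; auto.
           apply Hold; eauto.
Qed.

Lemma set_action_fold x x' : is_set_name S x ->
  (forall w, w ∈ x' <-> exists y p y' p',
    ⟨y, p⟩ ∈ x /\ set_action pi y y' /\ ⟨p, p'⟩ ∊ pi /\ w = ⟨y', p'⟩) ->
  set_action pi x x'.
Proof.
  intros Hx H. destruct (set_action_total x Hx) as [x2 H2].
  replace x' with x2; [exact H2|]. apply (set_ext). intros w.
  rewrite H. apply set_action_unfold, H2.
Qed.

Lemma action_of_set x x' : is_set_name S x ->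
  (action pi (of_set M x) (of_set M x') <-> set_action pi x x').
Proof.
  intros Hx. split.
  - intros H. apply set_action_fold; [exact Hx|]. intros w.
    rewrite <- (gb_of_set HGB x' w), (H w).
    split; intros (y & p & y' & p' & H1 & H2); exists y, p, y', p';
      (split; [apply (gb_of_set HGB), H1|exact H2]).
  - intros H w. rewrite (gb_of_set HGB), (set_action_unfold x x' H).
    split; intros (y & p & y' & p' & H1 & H2); exists y, p, y', p';
      (split; [apply (gb_of_set HGB), H1|exact H2]).
Qed.

End Action.

Hint Resolve set_action_class : gb_class.

(** * Conditions, automorphisms and the filter *)

Lemma leq_cond p q : p ≼ q -> p ∊ cond S /\ q ∊ cond S.
Proof.
  intros H. destruct (proj1 (css_preorder hS) _ H) as (p' & q' & Hp & Hq & E).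
  apply (opair_inj) in E as [-> ->]. auto.
Qed.
Lemma leq_l p q : p ≼ q -> p ∊ cond S.
Proof. apply leq_cond. Qed.
Lemma leq_r p q : p ≼ q -> q ∊ cond S.
Proof. apply leq_cond. Qed.
Lemma leq_refl p : p ∊ cond S -> p ≼ p.
Proof. apply (css_preorder hS). Qed.
Lemma leq_trans p q r : p ≼ q -> q ≼ r -> p ≼ r.
Proof. apply (css_preorder hS). Qed.
Lemma one_cond : one S ∊ cond S.
Proof. apply (css_preorder hS). Qed.
Lemma leq_one p : p ∊ cond S -> p ≼ one S.
Proof. apply (css_preorder hS). Qed.

Section Automorphism.
Context {pi : classes M} (Hpi : in_G S pi).

Lemma aut_cond p q : ⟨p, q⟩ ∊ pi -> p ∊ cond S /\ q ∊ cond S.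
Proof.
  intros H. destruct (proj1 (css_automorphism hS Hpi) _ H) as (p' & q' & Hp & Hq & E).
  apply (opair_inj) in E as [-> ->]. auto.
Qed.
Lemma aut_total p : p ∊ cond S -> exists q, ⟨p, q⟩ ∊ pi.
Proof. apply (css_automorphism hS Hpi). Qed.
Lemma aut_fun p q q' : ⟨p, q⟩ ∊ pi -> ⟨p, q'⟩ ∊ pi -> q = q'.
Proof. apply (css_automorphism hS Hpi). Qed.
Lemma aut_onto q : q ∊ cond S -> exists p, ⟨p, q⟩ ∊ pi.
Proof. apply (css_automorphism hS Hpi). Qed.
Lemma aut_leq p q p' q' : ⟨p, p'⟩ ∊ pi -> ⟨q, q'⟩ ∊ pi -> (p ≼ q <-> p' ≼ q').
Proof. apply (css_automorphism hS Hpi). Qed.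
Lemma aut_one : ⟨one S, one S⟩ ∊ pi.
Proof. apply (css_automorphism hS Hpi). Qed.
Lemma aut_inj p p' q : ⟨p, q⟩ ∊ pi -> ⟨p', q⟩ ∊ pi -> p = p'.
Proof. apply (css_automorphism hS Hpi). Qed.

Lemma act_total x : is_set_name S x -> exists x', set_action pi x x'.
Proof. apply (set_action_total pi aut_fun). Qed.

Lemma act_fold x x' : is_set_name S x ->
  (forall w, w ∈ x' <-> exists y p y' p',
    ⟨y, p⟩ ∈ x /\ set_action pi y y' /\ ⟨p, p'⟩ ∊ pi /\ w = ⟨y', p'⟩) ->
  set_action pi x x'.
Proof. apply (set_action_fold pi aut_fun). Qed.

Lemma act_member x x' y p y' p' : set_action pi x x' -> ⟨y, p⟩ ∈ x ->
  set_action pi y y' -> ⟨p, p'⟩ ∊ pi -> ⟨y', p'⟩ ∈ x'.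
Proof.
  intros Hx Hy Hyy Hpp. apply (set_action_unfold pi _ _ Hx).
  exists y, p, y', p'. auto.
Qed.

Lemma act_member_inv x x' y' p' : set_action pi x x' -> ⟨y', p'⟩ ∈ x' ->
  exists y p, ⟨y, p⟩ ∈ x /\ set_action pi y y' /\ ⟨p, p'⟩ ∊ pi.
Proof.
  intros Hx Hy. apply (set_action_unfold pi _ _ Hx) in Hy
    as (y & p & y1 & p1 & H1 & H2 & H3 & E).
  apply (opair_inj) in E as [-> ->]. eauto.
Qed.

Lemma act_name x x' : is_set_name S x -> set_action pi x x' -> is_set_name S x'.
Proof.
  intros Hx. revert x'. revert x Hx.
  apply (name_ind (fun x => forall x', set_action pi x x' -> is_set_name S x')).
  { prove_class. }
  intros x Hx IH x' Hact. apply (name_intro). intros w Hw.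
  apply (set_action_unfold pi _ _ Hact) in Hw
    as (y & p & y' & p' & H1 & H2 & H3 & ->).
  exists y', p'. split; [reflexivity|]. split; [eauto|]. exact (proj2 (aut_cond _ _ H3)).
Qed.

End Automorphism.

Lemma comp_iff pi sg tau : is_comp pi sg tau -> forall p r,
  ⟨p, r⟩ ∊ tau <-> exists q, ⟨p, q⟩ ∊ pi /\ ⟨q, r⟩ ∊ sg.
Proof.
  intros H p r. rewrite (H _). split.
  - intros (p' & q & r' & H1 & H2 & E). apply (opair_inj) in E as [-> ->]. eauto.
  - intros (q & H1 & H2). exists p, q, r. auto.
Qed.

Lemma inverse_iff pi tau : is_inverse pi tau -> forall p q,
  ⟨q, p⟩ ∊ tau <-> ⟨p, q⟩ ∊ pi.
Proof.
  intros H p q. rewrite (H _). split.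
  - intros (p' & q' & H1 & E). apply (opair_inj) in E as [-> ->]. auto.
  - intros H1. exists p, q. auto.
Qed.

Lemma act_comp pi sg tau x x' x'' : in_G S pi -> in_G S sg -> in_G S tau ->
  is_comp pi sg tau -> is_set_name S x ->
  set_action pi x x' -> set_action sg x' x'' -> set_action tau x x''.
Proof.
  intros Hpi Hsg Htau Hc Hx. revert x' x''. revert x Hx.
  apply (name_ind (fun x => forall x' x'',
    set_action pi x x' -> set_action sg x' x'' -> set_action tau x x'')).
  { prove_class. }
  intros x Hx IH x' x'' H1 H2. apply (act_fold Htau); [exact Hx|]. intros w.
  rewrite (set_action_unfold sg _ _ H2). split.
  - intros (y' & p' & y'' & p'' & Hy' & Hyy & Hpp & ->).
    destruct (act_member_inv _ _ _ _ H1 Hy') as (y & p & Hy & Hyy' & Hpp').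
    exists y, p, y'', p''. split; [exact Hy|]. split; [eauto|]. split; [|reflexivity].
    apply (comp_iff _ _ _ Hc). eauto.
  - intros (y & p & y'' & p'' & Hy & Hyy & Hpp & ->).
    destruct (name_dom _ _ _ Hx Hy) as [Hny _].
    destruct (act_total Hpi y Hny) as [y' Hy'].
    destruct (act_total Hsg y' (act_name Hpi _ _ Hny Hy')) as [y2 Hy2].
    rewrite (set_action_fun tau y y'' y2 Hyy (IH _ _ Hy _ _ Hy' Hy2)).
    apply (comp_iff _ _ _ Hc) in Hpp as (p' & Hp' & Hpp').
    exists y', p', y2, p''. repeat split; auto.
    exact (act_member _ _ _ _ _ _ H1 Hy Hy' Hp').
Qed.

Lemma act_inverse pi tau x x' : in_G S pi -> in_G S tau -> is_inverse pi tau ->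
  is_set_name S x -> set_action pi x x' -> set_action tau x' x.
Proof.
  intros Hpi Htau Hi Hx. revert x'. revert x Hx.
  apply (name_ind (fun x => forall x', set_action pi x x' -> set_action tau x' x)).
  { prove_class. }
  intros x Hx IH x' H1. apply (act_fold Htau); [exact (act_name Hpi _ _ Hx H1)|].
  intros w. split.
  - intros Hw. destruct (name_pair _ _ Hx Hw) as (y & p & -> & Hy & Hp).
    destruct (act_total Hpi y Hy) as [y' Hy']. destruct (aut_total Hpi p Hp) as [p' Hp'].
    exists y', p', y, p. split; [exact (act_member _ _ _ _ _ _ H1 Hw Hy' Hp')|].
    split; [eauto|]. split; [apply (inverse_iff _ _ Hi), Hp'|reflexivity].
  - intros (y' & p' & y & p & Hy' & Hyy & Hpp & ->).
    destruct (act_member_inv _ _ _ _ H1 Hy') as (y0 & p0 & Hy & Hyy' & Hpp').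
    apply (inverse_iff _ _ Hi) in Hpp. rewrite (aut_inj Hpi _ _ _ Hpp Hpp').
    rewrite (set_action_fun tau y' y y0 Hyy (IH _ _ Hy _ Hyy')). exact Hy.
Qed.

Lemma act_identity i x : in_G S i -> is_identity S i -> is_set_name S x ->
  set_action i x x.
Proof.
  intros Hi Hid.
  assert (E : forall p q, ⟨p, q⟩ ∊ i <-> p ∊ cond S /\ p = q).
  { intros p q. rewrite (Hid _). split.
    - intros (r & Hr & E). apply (opair_inj) in E as [-> ->]. auto.
    - intros [Hp ->]. eauto. }
  revert x. apply (name_ind (fun x => set_action i x x)). { prove_class. }
  intros x Hx IH. apply (act_fold Hi); [exact Hx|]. intros w. split.
  - intros Hw. destruct (name_pair _ _ Hx Hw) as (y & p & -> & Hy & Hp).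
    exists y, p, y, p. split; [exact Hw|]. split; [eauto|].
    split; [apply E; auto|reflexivity].
  - intros (y & p & y' & p' & Hy & Hyy & Hpp & ->). apply E in Hpp as [_ <-].
    rewrite (set_action_fun i y y' y Hyy (IH _ _ Hy)). exact Hy.
Qed.

Lemma in_base_dom a pi : in_base S a pi -> in_dom (CF S) a.
Proof. intros (d & Hd & _). exists d. exact Hd. Qed.

Lemma in_base_G a pi : in_base S a pi -> in_G S pi.
Proof. intros H. exact (proj1 (css_subgroup hS (in_base_dom _ _ H)) pi H). Qed.

Lemma in_base_inverse a pi : in_base S a pi ->
  exists tau, is_inverse pi tau /\ in_base S a tau.
Proof. intros H. apply (css_subgroup hS (in_base_dom _ _ H)), H. Qed.

Lemma inverse_symmetric pi tau : in_G S pi -> is_inverse pi tau -> is_inverse tau pi.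
Proof.
  intros Hpi H w. split.
  - intros Hw. destruct (proj1 (css_automorphism hS Hpi) w Hw) as (p & q & _ & _ & ->).
    exists q, p. split; [apply (inverse_iff _ _ H), Hw|reflexivity].
  - intros (q & p & Hqp & ->). apply (inverse_iff _ _ H), Hqp.
Qed.

Lemma section_exists (C : classes M) d : exists X, is_section C d X.
Proof.
  destruct (class_pred_intro (fun y => ⟨d, y⟩ ∊ C)) as [X HX]; [prove_definable|].
  exists X. exact HX.
Qed.

(** [set_action] for the automorphism with index [d].  Quantifying over indices
    instead of automorphisms keeps [HS] first-order. *)
Definition indexed_action d x x' : Prop := exists f : sets M,
  ((forall w, w ∈ f -> exists x x', w = ⟨x, x'⟩)
  /\ (forall x x1 x2, ⟨x, x1⟩ ∈ f -> ⟨x, x2⟩ ∈ f -> x1 = x2)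
  /\ (forall x x', ⟨x, x'⟩ ∈ f ->
        (forall y p, ⟨y, p⟩ ∈ x -> exists y', ⟨y, y'⟩ ∈ f) /\
        (forall w, w ∈ x' <-> exists y p y' p',
           ⟨y, p⟩ ∈ x /\ ⟨y, y'⟩ ∈ f /\ ⟨d, ⟨p, p'⟩⟩ ∊ CG S /\ w = ⟨y', p'⟩)))
  /\ ⟨x, x'⟩ ∈ f.

Lemma indexed_action_class : class_rel3 indexed_action.
Proof. unfold indexed_action. prove_class. Qed.
Hint Resolve indexed_action_class : gb_class.

Lemma indexed_action_iff d pi x x' : is_section (CG S) d pi ->
  (indexed_action d x x' <-> set_action pi x x').
Proof.
  intros H. assert (H' : forall p q, ⟨d, ⟨p, q⟩⟩ ∊ CG S <-> ⟨p, q⟩ ∊ pi).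
  { intros p q. symmetry. apply H. }
  unfold indexed_action, set_action, is_action_attempt.
  setoid_rewrite H'. tauto.
Qed.

Definition fixed_by_base (X : classes M) : Prop :=
  exists a, in_dom (CF S) a /\ forall pi, in_base S a pi -> action pi X X.

Lemma in_F_base a : in_dom (CF S) a -> in_F S (in_base S a).
Proof.
  intros Ha. split; [exact (css_subgroup hS Ha)|]. split; [|eauto].
  destruct (section_exists (CF S) a) as [C HC]. exists C. split.
  - intros b Hb. apply HC in Hb. destruct (css_CF hS _ Hb) as (a' & d & Hd & E).
    apply (opair_inj) in E as [_ ->]. exact Hd.
  - intros pi. unfold in_base. split; intros (d & Hd & Hs); exists d;
      (split; [apply HC, Hd|exact Hs]).
Qed.

(** Membership of a stabilizer in the filter quantifies over classes in its
    definition.  It reduces to the base because a stabilizer is automatically a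
    subgroup, and by comprehension it is given by a class of indices. *)
Lemma sym_in_F X : is_name S X -> (in_F S (sym S X) <-> fixed_by_base X).
Proof.
  intros HX. split.
  { intros (_ & _ & a & Ha & H). exists a. split; [exact Ha|].
    intros pi Hpi. apply H, Hpi. }
  intros (a & Ha & H).
  assert (Hmem : forall y p, ⟨y, p⟩ ∊ X -> is_set_name S y /\ p ∊ cond S).
  { intros y p Hy. destruct (HX _ Hy) as (y' & p' & Hy' & Hp' & E).
    apply (opair_inj) in E as [-> ->]. auto. }
  assert (Hact : forall pi y p y' p', action pi X X -> ⟨y, p⟩ ∊ X ->
    set_action pi y y' -> ⟨p, p'⟩ ∊ pi -> ⟨y', p'⟩ ∊ X).
  { intros pi y p y' p' HpiX Hy Hyy Hpp. apply HpiX. exists y, p, y', p'. auto. }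
  assert (Hact' : forall pi y' p', action pi X X -> ⟨y', p'⟩ ∊ X ->
    exists y p, ⟨y, p⟩ ∊ X /\ set_action pi y y' /\ ⟨p, p'⟩ ∊ pi).
  { intros pi y' p' HpiX Hy. apply HpiX in Hy as (y & p & y1 & p1 & H1 & H2 & H3 & E).
    apply (opair_inj) in E as [-> ->]. eauto. }
  split; [split; [intros pi Hpi; apply Hpi|split; [|split]]|split].
  - destruct (proj1 (css_group hS)) as (i & Hi & HiG). exists i. split; [exact Hi|].
    split; [exact HiG|].
    assert (E : forall p q, ⟨p, q⟩ ∊ i <-> p ∊ cond S /\ p = q).
    { intros p q. rewrite (Hi _). split.
      - intros (r & Hr & E). apply (opair_inj) in E as [-> ->]. auto.
      - intros [Hp ->]. eauto. }
    intros w. split.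
    + intros Hw. destruct (HX w Hw) as (y & p & Hy & Hp & ->).
      exists y, p, y, p. split; [exact Hw|].
      split; [apply act_identity; assumption|]. split; [apply E; auto|reflexivity].
    + intros (y & p & y' & p' & Hy & Hyy & Hpp & ->). apply E in Hpp as [_ <-].
      destruct (Hmem _ _ Hy) as [Hny _].
      rewrite (set_action_fun i y y' y Hyy); [exact Hy|].
      apply act_identity; assumption.
  - intros pi sg [HpiG HpiX] [HsgG HsgX].
    destruct (proj1 (proj2 (css_group hS)) pi sg HpiG HsgG) as (tau & Hc & HtG).
    exists tau. split; [exact Hc|]. split; [exact HtG|].
    intros w. split.
    + intros Hw. destruct (HX w Hw) as (y'' & p'' & _ & _ & ->).
      destruct (Hact' sg _ _ HsgX Hw) as (y' & p' & Hy' & Hyy' & Hpp').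
      destruct (Hact' pi _ _ HpiX Hy') as (y & p & Hy & Hyy & Hpp).
      exists y, p, y'', p''. split; [exact Hy|].
      split; [exact (act_comp _ _ _ _ _ _ HpiG HsgG HtG Hc (proj1 (Hmem _ _ Hy)) Hyy Hyy')|].
      split; [apply (comp_iff _ _ _ Hc); eauto|reflexivity].
    + intros (y & p & y'' & p'' & Hy & Hyy & Hpp & ->).
      destruct (Hmem _ _ Hy) as [Hny _].
      destruct (act_total HpiG y Hny) as [y' Hy'].
      destruct (act_total HsgG y' (act_name HpiG _ _ Hny Hy')) as [y2 Hy2].
      rewrite (set_action_fun tau y y'' y2 Hyy
        (act_comp _ _ _ _ _ _ HpiG HsgG HtG Hc Hny Hy' Hy2)).
      apply (comp_iff _ _ _ Hc) in Hpp as (p' & Hp' & Hpp').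
      eauto.
  - intros pi [HpiG HpiX].
    destruct (proj2 (proj2 (css_group hS)) pi HpiG) as (tau & Hi & HtG).
    exists tau. split; [exact Hi|]. split; [exact HtG|]. intros w. split.
    + intros Hw. destruct (HX w Hw) as (y & p & Hy & Hp & ->).
      destruct (act_total HpiG y Hy) as [y' Hy'].
      destruct (aut_total HpiG p Hp) as [p' Hp'].
      exists y', p', y, p. split; [eauto|].
      split; [exact (act_inverse _ _ _ _ HpiG HtG Hi Hy Hy')|].
      split; [apply (inverse_iff _ _ Hi), Hp'|reflexivity].
    + intros (y' & p' & y & p & Hy' & Hyy & Hpp & ->).
      destruct (Hact' pi _ _ HpiX Hy') as (y0 & p0 & Hy & Hyy' & Hpp').
      apply (inverse_iff _ _ Hi) in Hpp. rewrite (aut_inj HpiG _ _ _ Hpp Hpp').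
      rewrite (set_action_fun tau y' y y0 Hyy); [exact Hy|].
      exact (act_inverse _ _ _ _ HpiG HtG Hi (proj1 (Hmem _ _ Hy)) Hyy').
  - destruct (class_pred_intro (fun d => in_dom (CG S) d /\ forall w, w ∊ X <->
      exists y p y' p', ⟨y, p⟩ ∊ X /\ indexed_action d y y' /\
        ⟨d, ⟨p, p'⟩⟩ ∊ CG S /\ w = ⟨y', p'⟩)) as [C HC]; [prove_definable|].
    assert (E : forall d pi, is_section (CG S) d pi -> in_dom (CG S) d ->
      (d ∊ C <-> action pi X X)).
    { intros d pi Hd Hdom. rewrite HC. unfold action.
      setoid_rewrite <- (fun p q => Hd ⟨p, q⟩).
      setoid_rewrite (fun y y' => indexed_action_iff d pi y y' Hd). tauto. }
    exists C. split; [intros b Hb; apply HC, Hb|].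
    intros pi. split.
    + intros [(d & Hdom & Hd) Hpi]. exists d. split; [|exact Hd].
      apply (E d pi Hd Hdom), Hpi.
    + intros (d & HdC & Hd). assert (Hdom : in_dom (CG S) d) by apply HC, HdC.
      split; [exists d; auto|]. apply (E d pi Hd Hdom), HdC.
  - exists a. split; [exact Ha|]. intros pi Hpi.
    split; [exact (in_base_G _ _ Hpi)|exact (H pi Hpi)].
Qed.

(** * Hereditarily symmetric names *)

Definition fixed_set x : Prop :=
  exists a, in_dom (CF S) a /\ forall pi, in_base S a pi -> set_action pi x x.

Lemma symmetric_set_iff x :
  is_symmetric_name S (of_set M x) <-> is_set_name S x /\ fixed_set x.
Proof.
  unfold is_symmetric_name. rewrite (is_name_of_set).
  assert (E : is_set_name S x -> (fixed_by_base (of_set M x) <-> fixed_set x)).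
  { intros Hx. split; intros (a & Ha & H); exists a; (split; [exact Ha|]);
      intros pi Hpi; apply (action_of_set pi (aut_fun (in_base_G _ _ Hpi)) x x Hx); auto. }
  split; intros [Hx H]; (split; [exact Hx|]).
  - apply E; [exact Hx|]. apply sym_in_F; [apply (is_name_of_set), Hx|exact H].
  - apply sym_in_F; [apply (is_name_of_set), Hx|]. apply E; assumption.
Qed.

Lemma class_pred_equiv (P Q : sets M -> Prop) :
  (forall x, P x <-> Q x) -> class_pred P -> class_pred Q.
Proof. intros H [X HX]. exists X. intros x. rewrite HX. apply H. Qed.

Lemma fixed_set_class : class_pred fixed_set.
Proof.
  apply (class_pred_equiv (fun x => exists a, in_dom (CF S) a /\
    forall d, ⟨a, d⟩ ∊ CF S -> indexed_action d x x)); [|prove_class].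
  intros x. split; intros (a & Ha & H); exists a; (split; [exact Ha|]).
  - intros pi (d & Hd & Hs). apply (indexed_action_iff d pi x x Hs), H, Hd.
  - intros d Hd. destruct (section_exists (CG S) d) as [pi Hpi].
    apply (indexed_action_iff d pi x x Hpi), H. exists d. auto.
Qed.
Hint Resolve fixed_set_class : gb_class.

Lemma symmetric_set_class : class_pred (fun x => is_symmetric_name S (of_set M x)).
Proof.
  apply (class_pred_equiv (fun x => is_set_name S x /\ fixed_set x)); [|prove_class].
  intros x. symmetry. apply symmetric_set_iff.
Qed.

Lemma HS_class : class_pred (HS S).
Proof. exact (hereditarily_class _ symmetric_set_class). Qed.
Hint Resolve HS_class : gb_class.

Lemma HS_name x : HS S x -> is_set_name S x.
Proof. intros H. apply hereditarily_elim in H as [H _]. apply symmetric_set_iff, H. Qed.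

Lemma HS_dom x y p : HS S x -> ⟨y, p⟩ ∈ x -> HS S y.
Proof. intros H Hy. apply hereditarily_elim in H as [_ H]. exact (H y p Hy). Qed.

Lemma HS_cond x y p : HS S x -> ⟨y, p⟩ ∈ x -> p ∊ cond S.
Proof. intros H Hy. exact (proj2 (name_dom _ _ _ (HS_name x H) Hy)). Qed.

Lemma HS_fixed x : HS S x -> fixed_set x.
Proof. intros H. apply hereditarily_elim in H as [H _]. apply symmetric_set_iff, H. Qed.

Lemma HS_intro x : (forall w, w ∈ x -> exists y p, w = ⟨y, p⟩ /\ HS S y /\ p ∊ cond S) ->
  fixed_set x -> HS S x.
Proof.
  intros H Hf. apply (hereditarily_intro); [exact symmetric_set_class|..].
  - apply symmetric_set_iff. split; [|exact Hf]. apply (name_intro). intros w Hw.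
    destruct (H w Hw) as (y & p & -> & Hy & Hp). exists y, p. auto using HS_name.
  - intros y p Hy. destruct (H _ Hy) as (y' & p' & E & Hy' & _).
    apply (opair_inj) in E as [-> _]. exact Hy'.
Qed.

Lemma HS_ind P : class_pred P ->
  (forall x, HS S x -> (forall y p, ⟨y, p⟩ ∈ x -> P y) -> P x) ->
  forall x, HS S x -> P x.
Proof. exact (hereditarily_ind _ P). Qed.

(** By normality of the filter: if H_a fixes x, then some H_c is contained in
    pi H_a pi^-1, which fixes pi(x). *)
Lemma HS_act pi x x' : in_G S pi -> HS S x -> set_action pi x x' -> HS S x'.
Proof.
  intros Hpi Hx. revert x'. revert x Hx.
  apply (HS_ind (fun x => forall x', set_action pi x x' -> HS S x')). { prove_class. }
  intros x Hx IH x' H1. apply HS_intro.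
  - intros w Hw. apply (set_action_unfold pi _ _ H1) in Hw
      as (y & p & y' & p' & Hy & Hyy & Hpp & ->).
    exists y', p'. split; [reflexivity|]. split; [eauto|].
    exact (proj2 (aut_cond Hpi _ _ Hpp)).
  - destruct (HS_fixed x Hx) as (a & Ha & Hfix). assert (HpiG := Hpi).
    destruct Hpi as (d & Hd & Hsec).
    destruct (css_normal hS Ha Hd Hsec) as (c & Hc & Hconj).
    exists c. split; [exact Hc|]. intros rho Hrho.
    destruct (Hconj rho Hrho) as (sg & Hsg & Hcj).
    assert (HsgG := in_base_G _ _ Hsg). assert (HrhoG := in_base_G _ _ Hrho).
    destruct (proj2 (proj2 (css_group hS)) pi HpiG) as (inv & Hi & HiG).
    destruct (proj1 (proj2 (css_group hS)) inv sg HiG HsgG) as (t1 & Ht1 & Ht1G).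
    destruct (proj1 (proj2 (css_group hS)) t1 pi Ht1G HpiG) as (t2 & Ht2 & Ht2G).
    assert (E : rho = t2).
    { apply (gb_class_extensionality HGB). intros w. rewrite (Hcj w), (Ht2 w). split.
      - intros (p & q & p' & q' & H2 & H3 & H4 & ->). exists p', q, q'.
        split; [|auto]. apply (comp_iff _ _ _ Ht1). exists p.
        split; [apply (inverse_iff _ _ Hi), H3|exact H2].
      - intros (p' & q & q' & H2 & H3 & ->). apply (comp_iff _ _ _ Ht1) in H2
          as (p & H4 & H5). apply (inverse_iff _ _ Hi) in H4. exists p, q, p', q'. auto. }
    rewrite E. assert (Hn := HS_name x Hx). assert (Hn' := act_name HpiG _ _ Hn H1).
    apply (act_comp t1 pi t2 x' x x'); auto.
    apply (act_comp inv sg t1 x' x x); auto.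
    exact (act_inverse _ _ _ _ HpiG HiG Hi Hn H1).
Qed.

(** * Deciding by sets of conditions *)

(** One inclusion is enough, as H_a is closed under inverses. *)
Lemma fixed_set_intro y a : is_set_name S y -> in_dom (CF S) a ->
  (forall pi v v' p p', in_base S a pi -> ⟨v, p⟩ ∈ y -> set_action pi v v' ->
    ⟨p, p'⟩ ∊ pi -> ⟨v', p'⟩ ∈ y) ->
  fixed_set y.
Proof.
  intros Hy Ha Hcl. exists a. split; [exact Ha|]. intros pi Hpi.
  assert (HpiG := in_base_G _ _ Hpi).
  apply (act_fold HpiG); [exact Hy|]. intros w. split.
  - intros Hw. destruct (name_pair _ _ Hy Hw) as (v & p & -> & Hv & Hp).
    destruct (in_base_inverse _ _ Hpi) as (tau & Hi & Htau).
    assert (HtG := in_base_G _ _ Htau).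
    destruct (act_total HtG v Hv) as [u Hu].
    destruct (aut_total HtG p Hp) as [q Hq].
    exists u, q, v, p. split; [exact (Hcl _ _ _ _ _ Htau Hw Hu Hq)|].
    split; [|split; [apply (inverse_iff _ _ Hi), Hq|reflexivity]].
    apply (act_inverse tau pi v u); auto.
    apply (inverse_symmetric); assumption.
  - intros (v & p & v' & p' & H1 & H2 & H3 & ->). eauto.
Qed.

(** The name {<v,1> : v in n}. *)
Lemma bullet_HS n a : (forall v, v ∈ n -> HS S v) -> in_dom (CF S) a ->
  (forall pi v v', in_base S a pi -> v ∈ n -> set_action pi v v' -> v' ∈ n) ->
  exists y : sets M, HS S y /\ forall w, w ∈ y <-> exists v, v ∈ n /\ w = ⟨v, one S⟩.
Proof.
  intros Hn Ha Hcl.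
  destruct (replacement (fun v w => w = ⟨v, one S⟩) n) as [y Hy].
  { prove_class. } { intros; subst; reflexivity. }
  exists y. split; [|exact Hy].
  assert (Hw : forall w, w ∈ y -> exists y p, w = ⟨y, p⟩ /\ HS S y /\ p ∊ cond S).
  { intros w Hw. apply Hy in Hw as (v & Hv & ->). exists v, (one S).
    auto using one_cond. }
  apply (HS_intro _ Hw). apply (fixed_set_intro y a).
  - apply (name_intro). intros w H. destruct (Hw w H) as (v & p & -> & Hv & Hp).
    exists v, p. auto using HS_name.
  - exact Ha.
  - intros pi v v' p p' Hpi Hv Hvv Hpp. apply Hy in Hv as (v0 & Hv0 & E).
    apply (opair_inj) in E as [-> ->].
    assert (HpiG := in_base_G _ _ Hpi).
    rewrite (aut_fun HpiG _ _ _ Hpp (aut_one HpiG)).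
    apply Hy. exists v'. eauto.
Qed.

Definition invariant a (G : sets M -> sets M -> Prop) : Prop :=
  forall pi w w' d d', in_base S a pi -> HS S w -> set_action pi w w' ->
    ⟨d, d'⟩ ∊ pi -> G w d -> G w' d'.

Lemma invariant_iff a G pi w w' d d' : invariant a G -> in_base S a pi -> HS S w ->
  set_action pi w w' -> ⟨d, d'⟩ ∊ pi -> (G w d <-> G w' d').
Proof.
  intros HG Hpi Hw Hww Hdd. split; [eauto|].
  destruct (in_base_inverse _ _ Hpi) as (tau & Hi & Htau).
  assert (HpiG := in_base_G _ _ Hpi). assert (HtG := in_base_G _ _ Htau).
  apply (HG tau); auto.
  - exact (HS_act _ _ _ HpiG Hw Hww).
  - exact (act_inverse _ _ _ _ HpiG HtG Hi (HS_name _ Hw) Hww).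
  - apply (inverse_iff _ _ Hi), Hdd.
Qed.

(** For w in dom(x) the conditions that satisfy G(w,-), or that have no extension
    satisfying it, form a dense class, and as an automorphism in H_c fixes x and
    preserves G, it maps the class at w to the class at its image.  If r satisfies
    G(w,-), then an element of the class at w that is compatible with r has an
    extension satisfying G(w,-), and is therefore of the first kind. *)
Lemma predense_decision (Hpre : combinatorially_pretame S) x p a (G : sets M -> sets M -> Prop) :
  HS S x -> p ∊ cond S -> in_dom (CF S) a -> class_rel G ->
  (forall w d d', G w d -> d' ≼ d -> G w d') -> invariant a G ->
  exists q e : sets M, q ≼ p /\
    (forall w d, ⟨w, d⟩ ∈ e -> d ∊ cond S /\ G w d) /\
    forall w t s, ⟨w, t⟩ ∈ x -> s ≼ q -> G w s ->
      exists d, ⟨w, d⟩ ∈ e /\ compatible S s d.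
Proof.
  intros Hx Hp Ha HG Hdown Hinv.
  destruct (domain x) as [i Hi].
  set (Dw := fun w d => d ∊ cond S /\ (G w d \/ forall d', d' ≼ d -> ~ G w d')).
  destruct (class_pred_intro (fun u => exists w d, u = ⟨w, d⟩ /\ w ∈ i /\ Dw w d))
    as [D HD]. { unfold Dw. prove_definable. }
  assert (HD' : forall w d, ⟨w, d⟩ ∊ D <-> w ∈ i /\ Dw w d).
  { intros w d. rewrite HD. split; [|intros H; exists w, d; auto].
    intros (w' & d' & E & H). apply (opair_inj) in E as [-> ->]. exact H. }
  destruct (HS_fixed x Hx) as (b & Hb & Hfix).
  destruct (css_directed hS Ha Hb) as (c & Hc & Hcab).
  assert (HiHS : forall w, w ∈ i -> HS S w).
  { intros w Hw. apply Hi in Hw as [t Ht]. exact (HS_dom _ _ _ Hx Ht). }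
  assert (Hclosed : forall pi v v', in_base S c pi -> v ∈ i -> set_action pi v v' -> v' ∈ i).
  { intros pi v v' Hpi Hv Hvv. apply Hi in Hv as [t Ht].
    destruct (aut_total (in_base_G _ _ Hpi) t (HS_cond _ _ _ Hx Ht))
      as [t' Ht'].
    apply Hi. exists t'.
    exact (act_member _ _ _ _ _ _ (Hfix pi (proj2 (Hcab pi Hpi))) Ht Hvv Ht'). }
  destruct (Hpre p i D Hp) as (q & e & Hq & _ & He).
  - split; [|split; [|split; [|split]]].
    + intros w Hw. apply HD in Hw as (v & d & -> & Hv & _).
      exists v, d. split; [apply (gb_of_set HGB), Hv|reflexivity].
    + intros w d Hw. apply HD' in Hw. apply Hw.
    + intros w Hw. apply HiHS, (gb_of_set HGB), Hw.
    + destruct (bullet_HS i c HiHS Hc Hclosed) as (y & Hy & Hyi).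
      exists (of_set M y). split.
      * intros w. rewrite (gb_of_set HGB), Hyi.
        split; intros (v & Hv & E); exists v; (split; [apply (gb_of_set HGB), Hv|exact E]).
      * apply (symmetric_set_iff). split;
          [exact (HS_name _ Hy)|exact (HS_fixed _ Hy)].
    + exists (in_base S c). split; [exact (in_F_base c Hc)|].
      intros pi w Hpi Hw. apply (gb_of_set HGB) in Hw.
      assert (HpiG := in_base_G _ _ Hpi).
      destruct (act_total HpiG w (HS_name w (HiHS w Hw))) as [w' Hw'].
      exists w'. split; [exact Hw'|].
      assert (Hwi := Hclosed pi w w' Hpi Hw Hw').
      split; [apply (gb_of_set HGB), Hwi|].
      intros Di Dj HDi HDj d'. rewrite (HDj d'), HD'.
      assert (Hequiv : forall d d', ⟨d, d'⟩ ∊ pi -> (G w d <-> G w' d')).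
      { intros d d1 Hd.
        exact (invariant_iff a G pi w w' d d1 Hinv (proj1 (Hcab pi Hpi)) (HiHS w Hw) Hw' Hd). }
      assert (Hequiv' : forall d d', ⟨d, d'⟩ ∊ pi -> (Dw w d <-> Dw w' d')).
      { intros d d1 Hd. unfold Dw. rewrite (Hequiv _ _ Hd).
        destruct (aut_cond HpiG _ _ Hd) as [Hc1 Hc2].
        split; intros [_ [H|H]]; (split; [assumption|]); auto; right; intros s Hs.
        - destruct (aut_onto HpiG s (leq_l _ _ Hs)) as [r Hr].
          rewrite <- (Hequiv _ _ Hr). apply H.
          apply (aut_leq HpiG _ _ _ _ Hr Hd), Hs.
        - destruct (aut_total HpiG s (leq_l _ _ Hs)) as [r Hr].
          rewrite (Hequiv _ _ Hr). apply H.
          apply (aut_leq HpiG _ _ _ _ Hr Hd), Hs. }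
      split.
      * intros [_ H]. destruct (aut_onto HpiG d' (proj1 H)) as [d Hd].
        exists d. split; [|exact Hd]. apply HDi, HD'. split; [exact Hw|].
        apply (Hequiv' d d' Hd), H.
      * intros (d & Hd & Hdd). apply HDi, HD' in Hd as [_ Hd].
        split; [exact Hwi|]. apply (Hequiv' d d' Hdd), Hd.
  - intros w Di Hw HDi. split.
    + intros d Hd. apply HDi, HD' in Hd. apply Hd.
    + intros r Hr. destruct (classic (exists d, d ≼ r /\ G w d)) as [(d & Hd & HGd)|Hno].
      * exists d. split; [|exact Hd]. apply HDi, HD'. split; [exact Hw|].
        split; [exact (leq_l _ _ Hd)|auto].
      * exists r. split; [|exact (leq_refl r Hr)]. apply HDi, HD'.
        split; [exact Hw|]. split; [exact Hr|]. right. intros d Hd HGd. eauto.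
  - destruct (separation (fun u => exists w d, u = ⟨w, d⟩ /\ d ∊ cond S /\ G w d) e)
      as [e' He']. { prove_class. }
    exists q, e'. split; [exact Hq|]. split.
    + intros w d H. apply He' in H as (_ & w' & d' & E & H).
      apply (opair_inj) in E as [-> ->]. exact H.
    + intros w t s Ht Hs HGs.
      assert (Hw : w ∈ i) by (apply Hi; eauto).
      destruct (section_exists D w) as [Di HDi].
      destruct (section_exists (of_set M e) w) as [di Hdi].
      destruct (He w Di di Hw HDi Hdi) as [Hsub [_ Hpred]].
      destruct (Hpred s (leq_l _ _ Hs) Hs) as (d & Hd & Hcomp).
      exists d. split; [|exact Hcomp].
      apply He'. split; [apply (gb_of_set HGB), Hdi, Hd|].
      exists w, d. split; [reflexivity|].
      apply Hsub, HDi, HD' in Hd as [_ [Hdc HGd]]. split; [exact Hdc|].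
      destruct HGd as [HGd|Hno]; [exact HGd|].
      destruct Hcomp as (r & _ & Hrs & Hrd). exfalso. apply (Hno r Hrd). eauto.
Qed.

(** * Symmetric covers of sets of names *)

Definition orbit a v v' : Prop :=
  exists d, ⟨a, d⟩ ∊ CF S /\ indexed_action d v v'.

Lemma orbit_iff a v v' : orbit a v v' <-> exists pi, in_base S a pi /\ set_action pi v v'.
Proof.
  split.
  - intros (d & Hd & H). destruct (section_exists (CG S) d) as [pi Hpi].
    exists pi. split; [exists d; auto|]. apply (indexed_action_iff d pi v v' Hpi), H.
  - intros (pi & (d & Hd & Hpi) & H). exists d. split; [exact Hd|].
    apply (indexed_action_iff d pi v v' Hpi), H.
Qed.

Lemma union_of_orbits a d :
  (forall v, v ∈ d -> exists o : sets M, forall v', v' ∈ o <-> orbit a v v') ->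
  exists u : sets M, forall v', v' ∈ u <-> exists v, v ∈ d /\ orbit a v v'.
Proof.
  intros H. destruct (collection (fun v o => forall v', v' ∈ o <-> orbit a v v') d)
    as [c Hc]. { unfold orbit. prove_class. }
  destruct (gb_union HGB c) as [u Hu].
  apply (bounded_set _ u). { unfold orbit. prove_class. }
  intros v' (v & Hv & Hvv). destruct (Hc v Hv (H v Hv)) as (o & Ho & Hov).
  apply Hu. exists o. split; [exact Ho|]. apply Hov, Hvv.
Qed.

(** An image of v consists of pairs of an image of an element of dom(v) and a
    condition in b, because b is mapped to itself; so the orbit of v is bounded
    by the power set of a product of two sets. *)
Lemma orbit_is_set a b t :
  (forall pi, in_base S a pi -> is_image pi (of_set M b) (of_set M b)) ->
  (forall z y p, z ∈ t -> ⟨y, p⟩ ∈ z -> y ∈ t /\ p ∈ b) ->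
  forall v, is_set_name S v -> v ∈ t ->
  exists o : sets M, forall v', v' ∈ o <-> orbit a v v'.
Proof.
  intros Hb Ht.
  apply (name_ind (fun v => v ∈ t ->
    exists o : sets M, forall v', v' ∈ o <-> orbit a v v')).
  { unfold orbit. prove_class. }
  intros v Hv IH Hvt. destruct (domain v) as [d Hd].
  destruct (union_of_orbits a d) as [u Hu].
  { intros y Hy. apply Hd in Hy as [p Hp]. apply (IH y p Hp), (Ht v y p Hvt Hp). }
  destruct (product u b) as [c Hc]. destruct (gb_powerset HGB c) as [pc Hpc].
  apply (bounded_set _ pc). { unfold orbit. prove_class. }
  intros v' Hv'. apply orbit_iff in Hv' as (pi & Hpi & Hact).
  apply Hpc. intros w Hw. apply (set_action_unfold pi _ _ Hact) in Hw
    as (y & p & y' & p' & Hy & Hyy & Hpp & ->).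
  apply Hc. exists y', p'. split; [|split; [|reflexivity]].
  - apply Hu. exists y. split; [apply Hd; eauto|]. apply orbit_iff. eauto.
  - apply (gb_of_set HGB), (Hb pi Hpi). exists p. split; [|exact Hpp].
    apply (gb_of_set HGB), (Ht v y p Hvt Hy).
Qed.

Lemma symmetric_set_base b : is_symmetric_set S b ->
  exists a, in_dom (CF S) a /\
    forall pi, in_base S a pi -> is_image pi (of_set M b) (of_set M b).
Proof.
  intros (_ & _ & a & Ha & H). exists a. split; [exact Ha|].
  intros pi Hpi. apply H, Hpi.
Qed.

(** Stratification bounds all conditions occurring hereditarily in elements of
    [n] by a symmetric set, so [orbit_is_set] applies; the union of the orbits is
    closed under the stabilizer. *)
Lemma HS_cover (Hstr : stratified S) n : (forall v, v ∈ n -> HS S v) ->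
  exists y, HS S y /\ forall v, v ∈ n -> ⟨v, one S⟩ ∈ y.
Proof.
  intros Hn.
  destruct (hereditary_cover _ n (symmetric_set_class)) as (t & Hnt & Ht).
  assert (HtHS : forall z, z ∈ t -> HS S z).
  { intros z Hz. exists t. auto. }
  destruct (gb_union HGB t) as [ut Hut]. destruct (range ut) as [c Hc].
  destruct (Hstr c) as (b & Hbc & Hbsym & Hcb).
  { intros p Hp. apply Hc in Hp as [y Hy]. apply Hut in Hy as (z & Hz & Hy).
    exact (HS_cond _ _ _ (HtHS z Hz) Hy). }
  destruct (symmetric_set_base b Hbsym) as (a & Ha & Hab).
  destruct (union_of_orbits a n) as [o Ho].
  { intros v Hv. apply (orbit_is_set a b t Hab); [|apply (HS_name), Hn, Hv|].
    - intros z y p Hz Hy. split; [exact (proj2 (Ht z Hz) y p Hy)|].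
      apply Hcb, Hc. exists y. apply Hut. eauto.
    - apply Hnt; [exact Hv|exact (Hn v Hv)]. }
  destruct (css_subgroup hS Ha) as (_ & (i & Hid & Hi) & Hcomp & _).
  destruct (bullet_HS o a) as (y & Hy & Hyo).
  - intros v Hv. apply Ho in Hv as (v0 & Hv0 & Hvv). apply orbit_iff in Hvv
      as (pi & Hpi & Hact).
    exact (HS_act _ _ _ (in_base_G _ _ Hpi) (Hn v0 Hv0) Hact).
  - exact Ha.
  - intros pi v v' Hpi Hv Hvv. apply Ho in Hv as (v0 & Hv0 & Hv0v).
    apply orbit_iff in Hv0v as (sg & Hsg & Hact).
    destruct (Hcomp sg pi Hsg Hpi) as (tau & Hc' & Htau).
    apply Ho. exists v0. split; [exact Hv0|]. apply orbit_iff. exists tau.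
    split; [exact Htau|].
    apply (act_comp sg pi tau v0 v v'); eauto using in_base_G, HS_name.
  - exists y. split; [exact Hy|]. intros v Hv. apply Hyo. exists v.
    split; [|reflexivity]. apply Ho. exists v. split; [exact Hv|]. apply orbit_iff.
    exists i. split; [exact Hi|].
    apply (act_identity); eauto using in_base_G, HS_name.
Qed.

(** * Existence of the forcing relation *)

(** Some q below s forces w in y on the evidence of c: the triple <d,<w,u>> in c
    stands for the claim that d forces w = u. *)
Definition covered c s w y : Prop :=
  exists q u t d, q ≼ s /\ ⟨u, t⟩ ∈ y /\ q ≼ t /\ q ≼ d /\ ⟨d, ⟨w, u⟩⟩ ∈ c.

Definition covered_below c p x y : Prop :=
  forall w r s, ⟨w, r⟩ ∈ x -> s ≼ p -> s ≼ r -> covered c s w y.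

(** The claims made by c are justified by claims of c on elements of the domains.
    As names are well-founded, this self-reference does no harm. *)
Definition coherent c : Prop :=
  forall p x y, ⟨p, ⟨x, y⟩⟩ ∈ c ->
    is_set_name S x /\ is_set_name S y /\ covered_below c p x y /\ covered_below c p y x.

Definition certified p x y : Prop :=
  exists c d, coherent c /\ p ≼ d /\ ⟨d, ⟨x, y⟩⟩ ∈ c.

Hint Unfold covered covered_below coherent certified dense_below : gb_unfold.

Lemma certified_class : class_rel3 certified.
Proof. prove_class. Qed.
Hint Resolve certified_class : gb_class.

Lemma coherent_class : class_pred coherent.
Proof. prove_class. Qed.
Hint Resolve coherent_class : gb_class.

Lemma certified_down p q x y : certified p x y -> q ≼ p -> certified q x y.
Proof.
  intros (c & d & Hc & Hp & H) Hq. exists c, d. split; [exact Hc|].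
  split; [exact (leq_trans _ _ _ Hq Hp)|exact H].
Qed.

Lemma covered_mono c c' p x y : (forall w, w ∈ c -> w ∈ c') ->
  covered_below c p x y -> covered_below c' p x y.
Proof.
  intros Hcc H w r s Hw Hp Hr. destruct (H w r s Hw Hp Hr) as (q & u & t & d & Hq).
  exists q, u, t, d. intuition auto.
Qed.

Lemma coherent_union b c : (forall f, f ∈ b -> coherent f) ->
  (forall w, w ∈ c <-> exists f, f ∈ b /\ w ∈ f) -> coherent c.
Proof.
  intros Hb Hc p x y H. apply Hc in H as (f & Hf & H).
  destruct (Hb f Hf p x y H) as (Hx & Hy & H1 & H2).
  assert (Hfc : forall w, w ∈ f -> w ∈ c) by (intros w Hw; apply Hc; eauto).
  repeat split; auto; eapply covered_mono; eauto.
Qed.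

(** Stated for two sets of triples, of which c' is to be the image of c. *)
Lemma covered_below_equivariant pi c c' p p' x y x' y' : in_G S pi ->
  (forall w u d w' u' d', ⟨d, ⟨w, u⟩⟩ ∈ c -> ⟨d, d'⟩ ∊ pi -> set_action pi w w' ->
    set_action pi u u' -> ⟨d', ⟨w', u'⟩⟩ ∈ c') ->
  is_set_name S x -> is_set_name S y ->
  set_action pi x x' -> set_action pi y y' -> ⟨p, p'⟩ ∊ pi ->
  covered_below c p x y -> covered_below c' p' x' y'.
Proof.
  intros HpiG Hcc Hx Hy Hxx Hyy Hpp H w' r' s' Hw' Hs' Hr'.
  destruct (act_member_inv _ _ _ _ Hxx Hw') as (w & r & Hw & Hww & Hrr).
  destruct (aut_onto HpiG s' (leq_l _ _ Hs')) as [s Hs].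
  destruct (H w r s Hw) as (q & u & t & d & Hq & Hu & Ht & Hd & Hc).
  { apply (aut_leq HpiG _ _ _ _ Hs Hpp), Hs'. }
  { apply (aut_leq HpiG _ _ _ _ Hs Hrr), Hr'. }
  destruct (aut_total HpiG q (leq_l _ _ Hq)) as [q' Hq'].
  destruct (aut_total HpiG t (leq_r _ _ Ht)) as [t' Ht'].
  destruct (aut_total HpiG d (leq_r _ _ Hd)) as [d' Hd'].
  destruct (act_total HpiG u (proj1 (name_dom _ _ _ Hy Hu))) as [u' Hu'].
  exists q', u', t', d'. split; [apply (aut_leq HpiG _ _ _ _ Hq' Hs), Hq|].
  split; [exact (act_member _ _ _ _ _ _ Hyy Hu Hu' Ht')|].
  split; [apply (aut_leq HpiG _ _ _ _ Hq' Ht'), Ht|].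
  split; [apply (aut_leq HpiG _ _ _ _ Hq' Hd'), Hd|].
  eauto.
Qed.

Lemma certified_equivariant pi p p' x x' y y' : in_G S pi -> ⟨p, p'⟩ ∊ pi ->
  set_action pi x x' -> set_action pi y y' -> certified p x y -> certified p' x' y'.
Proof.
  intros HpiG Hpp Hxx Hyy (c & d & Hc & Hpd & H).
  destruct (replacement (fun v v' => exists d x y d' x' y', v = ⟨d, ⟨x, y⟩⟩ /\
    ⟨d, d'⟩ ∊ pi /\ set_action pi x x' /\ set_action pi y y' /\ v' = ⟨d', ⟨x', y'⟩⟩) c)
    as [c' Hc']. { prove_class. }
  { intros v v1 v2 _ (d1 & x1 & y1 & d1' & x1' & y1' & -> & E1 & E2 & E3 & ->)
      (d2 & x2 & y2 & d2' & x2' & y2' & E & F1 & F2 & F3 & ->).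
    apply (opair_inj) in E as [<- E]. apply (opair_inj) in E as [<- <-].
    rewrite (aut_fun HpiG _ _ _ E1 F1), (set_action_fun pi _ _ _ E2 F2),
      (set_action_fun pi _ _ _ E3 F3). reflexivity. }
  assert (Hcc : forall w u d w' u' d', ⟨d, ⟨w, u⟩⟩ ∈ c -> ⟨d, d'⟩ ∊ pi ->
    set_action pi w w' -> set_action pi u u' -> ⟨d', ⟨w', u'⟩⟩ ∈ c').
  { intros w u d0 w' u' d0' H1 H2 H3 H4. apply Hc'. exists ⟨d0, ⟨w, u⟩⟩.
    split; [exact H1|]. exists d0, w, u, d0', w', u'. auto. }
  destruct (aut_total HpiG d (leq_r _ _ Hpd)) as [d' Hd'].
  exists c', d'. split; [|split].
  - intros q' z' v' Hin. apply Hc' in Hin as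
      (w & Hw & q & z & v & q1 & z1 & v1 & -> & H1 & H2 & H3 & E).
    apply (opair_inj) in E as [<- E]. apply (opair_inj) in E as [<- <-].
    destruct (Hc q z v Hw) as (Hz & Hv & Hzv & Hvz).
    split; [exact (act_name HpiG _ _ Hz H2)|].
    split; [exact (act_name HpiG _ _ Hv H3)|].
    split; [exact (covered_below_equivariant pi c c' q q' z v z' v' HpiG Hcc Hz Hv H2 H3 H1 Hzv)
      |exact (covered_below_equivariant pi c c' q q' v z v' z' HpiG Hcc Hv Hz H3 H2 H1 Hvz)].
  - apply (aut_leq HpiG _ _ _ _ Hpp Hd'), Hpd.
  - exact (Hcc _ _ _ _ _ _ H Hd' Hxx Hyy).
Qed.

Definition densely_certified p x y : Prop :=
  dense_below S (fun q => certified q x y) p.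

Definition densely_in p x y : Prop :=
  dense_below S (fun q => exists z r,
    ⟨z, r⟩ ∈ y /\ leq S q r /\ densely_certified q x z) p.

Definition densely_sub p x y : Prop :=
  forall z r, ⟨z, r⟩ ∈ x -> forall s, s ≼ p -> s ≼ r ->
    exists q, q ≼ s /\ densely_in q z y.

Lemma dense_refl (F : sets M -> Prop) p : p ∊ cond S -> dense_below S F p ->
  exists r, r ≼ p /\ F r.
Proof. intros Hp H. exact (H p (leq_refl p Hp)). Qed.

(** This half of a certificate is what [predense_decision] provides: each pair in
    the set e comes with a certificate, Collection gathers these into one coherent
    set, and predensity shows that it covers whatever is forced. *)
Lemma covering_set (Hpre : combinatorially_pretame S) p x y :
  HS S x -> HS S y -> p ∊ cond S -> densely_sub p x y ->
  exists q c, q ≼ p /\ coherent c /\ covered_below c q x y.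
Proof.
  intros Hx Hy Hp Hsub.
  set (G := fun w d => exists u t, ⟨u, t⟩ ∈ y /\ d ≼ t /\ certified d w u).
  destruct (HS_fixed y Hy) as (a & Ha & Hfix).
  destruct (predense_decision Hpre x p a G Hx Hp Ha) as (q & e & Hq & He & Hdec).
  { unfold G. prove_class. }
  { intros w d d' (u & t & Hu & Ht & Hc) Hd. exists u, t. split; [exact Hu|].
    split; [exact (leq_trans _ _ _ Hd Ht)|exact (certified_down _ _ _ _ Hc Hd)]. }
  { intros pi w w' d d' Hpi Hw Hww Hdd (u & t & Hu & Ht & Hc).
    assert (HpiG := in_base_G _ _ Hpi).
    destruct (act_total HpiG u (proj1 (name_dom _ _ _ (HS_name _ Hy) Hu)))
      as [u' Hu'].
    destruct (aut_total HpiG t (leq_r _ _ Ht)) as [t' Ht'].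
    exists u', t'. split; [exact (act_member _ _ _ _ _ _ (Hfix pi Hpi) Hu Hu' Ht')|].
    split; [apply (aut_leq HpiG _ _ _ _ Hdd Ht'), Ht|].
    exact (certified_equivariant pi _ _ _ _ _ _ HpiG Hdd Hww Hu' Hc). }
  destruct (collection (fun v c => exists w d, v = ⟨w, d⟩ /\ coherent c /\
    exists u t d', ⟨u, t⟩ ∈ y /\ d ≼ t /\ d ≼ d' /\ ⟨d', ⟨w, u⟩⟩ ∈ c) e) as [b Hb].
  { prove_class. }
  destruct (separation coherent b) as [b' Hb']. { prove_class. }
  destruct (gb_union HGB b') as [c Hc].
  exists q, c. split; [exact Hq|]. split.
  { apply (coherent_union b'); [|exact Hc]. intros f Hf. apply Hb', Hf. }
  intros w r s Hw Hs Hr.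
  destruct (Hsub w r Hw s (leq_trans _ _ _ Hs Hq) Hr) as (q1 & Hq1 & Hin).
  destruct (dense_refl _ _ (leq_l _ _ Hq1) Hin) as (r1 & Hr1 & u & t & Hu & Ht & Hd).
  destruct (dense_refl _ _ (leq_l _ _ Hr1) Hd) as (r2 & Hr2 & Hcert).
  assert (Hr2s : r2 ≼ s).
  { apply (leq_trans _ r1 _ Hr2), (leq_trans _ q1 _ Hr1), Hq1. }
  destruct (Hdec w r r2 Hw (leq_trans _ _ _ Hr2s Hs)) as (d & Hde & r3 & _ & Hr3 & Hr3d).
  { exists u, t. split; [exact Hu|]. split; [exact (leq_trans _ _ _ Hr2 Ht)|exact Hcert]. }
  destruct (Hb _ Hde) as (c' & Hc' & w' & d0 & E & Hcoh & u' & t' & d' & Hu' & Ht' & Hd' & Hin').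
  { destruct (He w d Hde) as (Hdc & u0 & t0 & Hu0 & Ht0 & c0 & d0 & Hcoh & Hd0 & Hin0).
    exists c0, w, d. split; [reflexivity|]. split; [exact Hcoh|]. exists u0, t0, d0. auto. }
  apply (opair_inj) in E as [<- <-].
  exists r3, u', t', d'. split; [exact (leq_trans _ _ _ Hr3 Hr2s)|].
  split; [exact Hu'|]. split; [exact (leq_trans _ _ _ Hr3d Ht')|].
  split; [exact (leq_trans _ _ _ Hr3d Hd')|].
  apply Hc. exists c'. split; [apply Hb'; auto|exact Hin'].
Qed.

(** From left to right a certificate contains what is needed.  From right to left
    [covering_set] is used for x and y in turn, and the union of the two sets
    becomes a certificate when <q2,<x,y>> is added. *)
Lemma densely_certified_iff (Hpre : combinatorially_pretame S) p x y :
  HS S x -> HS S y -> p ∊ cond S ->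
  (densely_certified p x y <-> densely_sub p x y /\ densely_sub p y x).
Proof.
  intros Hx Hy Hp. split.
  - assert (Hhalf : forall c d z v r, coherent c -> r ≼ d ->
      covered_below c d z v -> forall w t, ⟨w, t⟩ ∈ z -> r ≼ t -> densely_in r w v).
    { intros c d z v r Hc Hrd Hcov w t Hw Hrt q Hq.
      destruct (Hcov w t q Hw) as (q2 & u & t' & d2 & Hq2 & Hu & Ht' & Hd2 & Hin).
      { exact (leq_trans _ _ _ Hq Hrd). } { exact (leq_trans _ _ _ Hq Hrt). }
      exists q2. split; [exact Hq2|]. exists u, t'. split; [exact Hu|]. split; [exact Ht'|].
      intros q3 Hq3. exists q3. split; [exact (leq_refl _ (leq_l _ _ Hq3))|].
      exists c, d2. split; [exact Hc|]. split; [exact (leq_trans _ _ _ Hq3 Hd2)|exact Hin]. }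
    intros H. split; intros w t Hw s Hs Ht; destruct (H s Hs) as (r & Hr & c & d & Hc & Hd & Hin);
      destruct (Hc d x y Hin) as (_ & _ & H1 & H2); exists r; (split; [exact Hr|]).
    + exact (Hhalf c d x y r Hc Hd H1 w t Hw (leq_trans _ _ _ Hr Ht)).
    + exact (Hhalf c d y x r Hc Hd H2 w t Hw (leq_trans _ _ _ Hr Ht)).
  - intros [H1 H2] s Hs.
    assert (Hmono : forall z v q, q ≼ p -> densely_sub p z v -> densely_sub q z v).
    { intros z v q Hq H w t Hw r Hr. apply (H w t Hw). exact (leq_trans _ _ _ Hr Hq). }
    destruct (covering_set Hpre s x y Hx Hy (leq_l _ _ Hs) (Hmono _ _ _ Hs H1))
      as (q1 & c1 & Hq1 & Hc1 & Hcov1).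
    assert (Hq1p := leq_trans _ _ _ Hq1 Hs).
    destruct (covering_set Hpre q1 y x Hy Hx (leq_l _ _ Hq1) (Hmono _ _ _ Hq1p H2))
      as (q2 & c2 & Hq2 & Hc2 & Hcov2).
    destruct (union2 c1 c2) as [c3 Hc3]. destruct (adjoin c3 ⟨q2, ⟨x, y⟩⟩) as [c Hc].
    assert (Hc1c : forall w, w ∈ c1 -> w ∈ c) by (intros w Hw; apply Hc; rewrite Hc3; auto).
    assert (Hc2c : forall w, w ∈ c2 -> w ∈ c) by (intros w Hw; apply Hc; rewrite Hc3; auto).
    exists q2. split; [exact (leq_trans _ _ _ Hq2 Hq1)|].
    exists c, q2. split; [|split; [exact (leq_refl _ (leq_l _ _ Hq2))|apply Hc; auto]].
    intros d z v Hin. apply Hc in Hin as [Hin|E].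
    + apply Hc3 in Hin as [Hin|Hin].
      * destruct (Hc1 d z v Hin) as (Hz & Hv & E1 & E2).
        split; [exact Hz|]. split; [exact Hv|].
        split; apply (covered_mono c1 c _ _ _ Hc1c); assumption.
      * destruct (Hc2 d z v Hin) as (Hz & Hv & E1 & E2).
        split; [exact Hz|]. split; [exact Hv|].
        split; apply (covered_mono c2 c _ _ _ Hc2c); assumption.
    + apply (opair_inj) in E as [-> E]. apply (opair_inj) in E as [-> ->].
      split; [exact (HS_name _ Hx)|]. split; [exact (HS_name _ Hy)|]. split.
      * apply (covered_mono c1 c q2 x y Hc1c). intros w r s' Hw Hs' Hr.
        apply (Hcov1 w r s' Hw (leq_trans _ _ _ Hs' Hq2) Hr).
      * exact (covered_mono c2 c q2 y x Hc2c Hcov2).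
Qed.

Lemma forcing_relation_exists (Hpre : combinatorially_pretame S) :
  admits_forcing_relations S.
Proof.
  assert (H1 : class_rel3 densely_certified) by (unfold densely_certified; prove_class).
  assert (H2 : class_rel3 densely_in) by (unfold densely_in; prove_class).
  assert (H3 : class_rel3 densely_sub) by (unfold densely_sub; prove_class).
  destruct H1 as [Req HReq], H2 as [Rin HRin], H3 as [Rsub HRsub].
  exists {| rel_in := Rin; rel_sub := Rsub; rel_eq := Req |}.
  intros p x y Hp Hx Hy. unfold forces_in, forces_sub, forces_eq, dense_below.
  cbn [rel_in rel_sub rel_eq].
  setoid_rewrite HRin. setoid_rewrite HRsub. setoid_rewrite HReq.
  split; [reflexivity|]. split; [reflexivity|].
  exact (densely_certified_iff Hpre p x y Hx Hy Hp).
Qed.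

Hint Unfold dense_below forces_in forces_eq forces_sub forces_cmem fc_not fc_and fc_ex
  : gb_unfold.

(** * Forced equality and membership *)

Context (A : atomic_relation) (HA : is_forcing_relation S A).
Notation feq := (forces_eq A).
Notation fmem p x X := (forces_cmem S A x X p).

(** Sets of conditions that are determined by density; on these [fc_all] and
    [fc_imp] have their expected meaning despite the double negation. *)
Definition regular (F : sets M -> Prop) : Prop :=
  (forall p q, F p -> q ≼ p -> F q) /\
  forall p, p ∊ cond S -> dense_below S F p -> F p.

Lemma dense_below_regular F : regular (dense_below S F).
Proof.
  split.
  - intros p q H Hq r Hr. exact (H r (leq_trans _ _ _ Hr Hq)).
  - intros p Hp H q Hq. destruct (H q Hq) as (r & Hr & HF).
    destruct (HF r (leq_refl _ (leq_l _ _ Hr))) as (s & Hs & HFs).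
    exists s. split; [exact (leq_trans _ _ _ Hs Hr)|exact HFs].
Qed.

Lemma fmem_regular x X : regular (fun p => fmem p x X).
Proof. apply dense_below_regular. Qed.

Lemma fmem_down p q x X : fmem p x X -> q ≼ p -> fmem q x X.
Proof. apply (proj1 (fmem_regular x X)). Qed.

Lemma forces_in_iff p x y : p ∊ cond S -> HS S x -> HS S y ->
  (forces_in A p x y <-> fmem p x (of_set M y)).
Proof.
  intros Hp Hx Hy. rewrite (proj1 (HA p x y Hp Hx Hy)).
  unfold forces_cmem, dense_below. setoid_rewrite (gb_of_set HGB). reflexivity.
Qed.

Definition fincl p x y : Prop :=
  forall z r s, ⟨z, r⟩ ∈ x -> s ≼ p -> s ≼ r -> fmem s z (of_set M y).

(** The clauses for inclusion and equality, where density of membership absorbs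
    the inner quantifier over extensions. *)
Lemma feq_iff p x y : p ∊ cond S -> HS S x -> HS S y ->
  (feq p x y <-> fincl p x y /\ fincl p y x).
Proof.
  intros Hp Hx Hy.
  assert (E : forall x y, HS S x -> HS S y -> (forces_sub A p x y <-> fincl p x y)).
  { clear x y Hx Hy. intros x y Hx Hy.
    destruct (HA p x y Hp Hx Hy) as (_ & Hsub & _). rewrite Hsub. split.
    - intros H z r s Hz Hs Hr. apply fmem_regular; [exact (leq_l _ _ Hs)|].
      intros s' Hs'. destruct (H z r Hz s') as (q & Hq & Hin).
      { exact (leq_trans _ _ _ Hs' Hs). } { exact (leq_trans _ _ _ Hs' Hr). }
      exists q. split; [exact Hq|]. apply forces_in_iff;
        eauto using leq_l, HS_dom.
    - intros H z r Hz s Hs Hr. exists s.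
      split; [exact (leq_refl _ (leq_l _ _ Hs))|].
      apply forces_in_iff; eauto using leq_l, HS_dom. }
  destruct (HA p x y Hp Hx Hy) as (_ & _ & Heq).
  rewrite Heq, (E x y Hx Hy), (E y x Hy Hx). reflexivity.
Qed.

Lemma feq_sym p x y : p ∊ cond S -> HS S x -> HS S y -> feq p x y -> feq p y x.
Proof. intros Hp Hx Hy. rewrite !feq_iff by assumption. tauto. Qed.

Lemma feq_down p q x y : HS S x -> HS S y -> feq p x y -> q ≼ p -> feq q x y.
Proof.
  intros Hx Hy H Hq. destruct (leq_cond _ _ Hq) as [Hqc Hpc].
  apply feq_iff in H as [H1 H2]; auto. apply feq_iff; auto.
  split; intros z r s Hz Hs; [eapply H1|eapply H2]; eauto using leq_trans.
Qed.

Lemma feq_regular x y : HS S x -> HS S y -> regular (fun p => feq p x y).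
Proof.
  intros Hx Hy. split.
  - intros p q. exact (feq_down p q x y Hx Hy).
  - intros p Hp H. apply feq_iff; auto.
    split; intros z r s Hz Hs Hr; (apply fmem_regular; [exact (leq_l _ _ Hs)|]);
      intros s' Hs'; (destruct (H s' (leq_trans _ _ _ Hs' Hs)) as (q & Hq & He));
      exists q; (split; [exact Hq|]);
      (apply feq_iff in He as [H1 H2]; eauto using leq_l);
      [apply (H1 z r)|apply (H2 z r)]; auto;
      eauto using leq_refl, leq_l, leq_trans.
Qed.

Lemma fmem_intro p x u t X : HS S x -> HS S u -> ⟨u, t⟩ ∊ X -> p ≼ t -> feq p x u ->
  fmem p x X.
Proof.
  intros Hx Hu HX Ht H q Hq. exists q. split; [exact (leq_refl _ (leq_l _ _ Hq))|].
  exists u, t. split; [exact HX|]. split; [exact (leq_trans _ _ _ Hq Ht)|].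
  exact (feq_down _ _ _ _ Hx Hu H Hq).
Qed.

(** The equality axioms, on which substitution in arbitrary formulas
    ([forces_congr]) rests, need induction on names. *)
Lemma feq_refl x p : HS S x -> p ∊ cond S -> feq p x x.
Proof.
  intros Hx. revert p. revert x Hx.
  apply (HS_ind (fun x => forall p, p ∊ cond S -> feq p x x)). { prove_class. }
  intros x Hx IH p Hp. apply feq_iff; auto.
  assert (Hi : fincl p x x); [|auto]. intros z r s Hz Hs Hr.
  assert (HzS := HS_dom _ _ _ Hx Hz).
  apply (fmem_intro s z z r); auto; [apply (gb_of_set HGB), Hz|].
  exact (IH z r Hz s (leq_l _ _ Hs)).
Qed.

Lemma feq_trans x y z p : HS S x -> HS S y -> HS S z -> p ∊ cond S ->
  feq p x y -> feq p y z -> feq p x z.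
Proof.
  intros Hx. revert y z p. revert x Hx.
  apply (HS_ind (fun x => forall y z p, HS S y -> HS S z -> p ∊ cond S ->
    feq p x y -> feq p y z -> feq p x z)). { prove_class. }
  intros x Hx IH y z p Hy Hz Hp Hxy Hyz.
  apply feq_iff in Hxy as [Hxy Hyx], Hyz as [Hyz Hzy]; auto. apply feq_iff; auto. split.
  - intros w r s Hw Hs Hr q Hq.
    destruct (Hxy w r s Hw Hs Hr q Hq) as (r1 & Hr1 & u & t & Hu & Ht & Hwu).
    apply (gb_of_set HGB) in Hu.
    assert (Hr1p : r1 ≼ p) by eauto using leq_trans.
    destruct (Hyz u t r1 Hu Hr1p Ht r1 (leq_refl _ (leq_l _ _ Hr1)))
      as (r2 & Hr2 & v & t' & Hv & Ht' & Huv).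
    assert (Hv' := Hv). apply (gb_of_set HGB) in Hv'.
    exists r2. split; [exact (leq_trans _ _ _ Hr2 Hr1)|]. exists v, t'.
    split; [exact Hv|]. split; [exact Ht'|].
    apply (IH w r Hw u v); eauto using HS_dom, leq_l.
    apply (feq_down r1); eauto using HS_dom.
  - intros v r s Hv Hs Hr q Hq.
    destruct (Hzy v r s Hv Hs Hr q Hq) as (r1 & Hr1 & u & t & Hu & Ht & Hvu).
    apply (gb_of_set HGB) in Hu.
    assert (Hr1p : r1 ≼ p) by eauto using leq_trans.
    destruct (Hyx u t r1 Hu Hr1p Ht r1 (leq_refl _ (leq_l _ _ Hr1)))
      as (r2 & Hr2 & w & t' & Hw & Ht' & Huw).
    assert (Hw' := Hw). apply (gb_of_set HGB) in Hw'.
    exists r2. split; [exact (leq_trans _ _ _ Hr2 Hr1)|]. exists w, t'.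
    split; [exact Hw|]. split; [exact Ht'|].
    assert (Hr2c := leq_l _ _ Hr2).
    assert (HwS := HS_dom _ _ _ Hx Hw'). assert (HuS := HS_dom _ _ _ Hy Hu).
    assert (HvS := HS_dom _ _ _ Hz Hv).
    (* The induction hypothesis speaks of equalities whose left side is in
       dom(x), so both equalities are reversed before and after using it. *)
    apply feq_sym; auto. apply (IH w t' Hw' u v); auto.
    + apply feq_sym; auto.
    + apply feq_sym; auto. apply (feq_down r1); auto.
Qed.

Definition HS_class_name X : Prop := forall y p, ⟨y, p⟩ ∊ X -> HS S y.

Lemma HS_class_name_of_set x : HS S x -> HS_class_name (of_set M x).
Proof. intros Hx y p Hy. apply (gb_of_set HGB) in Hy. exact (HS_dom _ _ _ Hx Hy). Qed.

Lemma fmem_congr_l p x x' X : HS S x -> HS S x' -> HS_class_name X -> p ∊ cond S ->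
  feq p x x' -> fmem p x X -> fmem p x' X.
Proof.
  intros Hx Hx' HX Hp He H q Hq. destruct (H q Hq) as (r & Hr & z & t & Hz & Ht & Hxz).
  exists r. split; [exact Hr|]. exists z, t. split; [exact Hz|]. split; [exact Ht|].
  assert (Hrc := leq_l _ _ Hr). assert (HzS := HX _ _ Hz).
  apply (feq_trans x' x z); auto. apply feq_sym; auto.
  apply (feq_down p); eauto using leq_trans.
Qed.

Lemma fmem_congr_r p x y y' : HS S x -> HS S y -> HS S y' -> p ∊ cond S ->
  feq p y y' -> fmem p x (of_set M y) -> fmem p x (of_set M y').
Proof.
  intros Hx Hy Hy' Hp He H. apply feq_iff in He as [He _]; auto.
  apply fmem_regular; [exact Hp|]. intros q Hq.
  destruct (H q Hq) as (r & Hr & z & t & Hz & Ht & Hxz).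
  apply (gb_of_set HGB) in Hz. exists r. split; [exact Hr|].
  assert (Hrc := leq_l _ _ Hr). assert (HzS := HS_dom _ _ _ Hy Hz).
  apply (fmem_congr_l r z x); auto.
  - apply HS_class_name_of_set, Hy'.
  - apply feq_sym; auto.
  - apply (He z t r Hz); eauto using leq_trans.
Qed.

(** * Invariance under automorphisms *)

(** The hypothesis on the members of [X] is what the induction in
    [feq_equivariant] has available; afterwards it holds outright. *)
Lemma fmem_transport pi p p' x x' X X' : in_G S pi -> HS_class_name X ->
  action pi X X' -> ⟨p, p'⟩ ∊ pi ->
  (forall u t u' k k', ⟨u, t⟩ ∊ X -> set_action pi u u' -> ⟨k, k'⟩ ∊ pi ->
    feq k x u -> feq k' x' u') ->
  fmem p x X -> fmem p' x' X'.
Proof.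
  intros HpiG HX Hact Hpp Heq H q' Hq'.
  destruct (aut_onto HpiG q' (leq_l _ _ Hq')) as [q Hq].
  destruct (H q) as (r & Hr & z & t & Hz & Ht & He).
  { apply (aut_leq HpiG _ _ _ _ Hq Hpp), Hq'. }
  destruct (aut_total HpiG r (leq_l _ _ Hr)) as [r' Hr'].
  destruct (aut_total HpiG t (leq_r _ _ Ht)) as [t' Ht'].
  destruct (act_total HpiG z (HS_name _ (HX _ _ Hz))) as [z' Hz'].
  exists r'. split; [apply (aut_leq HpiG _ _ _ _ Hr' Hq), Hr|].
  exists z', t'. split; [apply Hact; exists z, t, z', t'; auto|].
  split; [apply (aut_leq HpiG _ _ _ _ Hr' Ht'), Ht|]. eauto.
Qed.

Lemma fincl_transport pi p p' x x' y y' : in_G S pi -> HS S y ->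
  set_action pi x x' -> set_action pi y y' -> ⟨p, p'⟩ ∊ pi ->
  (forall z r u t z' u' k k', ⟨z, r⟩ ∈ x -> ⟨u, t⟩ ∈ y -> set_action pi z z' ->
    set_action pi u u' -> ⟨k, k'⟩ ∊ pi -> feq k z u -> feq k' z' u') ->
  fincl p x y -> fincl p' x' y'.
Proof.
  intros HpiG Hy Hxx Hyy Hpp Heq H z' r' s' Hz' Hs' Hr'.
  destruct (act_member_inv _ _ _ _ Hxx Hz') as (z & r & Hz & Hzz & Hrr).
  destruct (aut_onto HpiG s' (leq_l _ _ Hs')) as [s Hs].
  apply (fmem_transport pi s s' z z' (of_set M y)); auto using HS_class_name_of_set.
  - apply (action_of_set pi (aut_fun HpiG)); auto using HS_name.
  - intros u t u' k k' Hu Huu Hkk. apply (gb_of_set HGB) in Hu. eauto.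
  - apply (H z r s Hz); [apply (aut_leq HpiG _ _ _ _ Hs Hpp), Hs'|].
    apply (aut_leq HpiG _ _ _ _ Hs Hrr), Hr'.
Qed.

Lemma feq_equivariant pi x y x' y' p p' : in_G S pi -> HS S x -> HS S y ->
  set_action pi x x' -> set_action pi y y' -> ⟨p, p'⟩ ∊ pi -> feq p x y -> feq p' x' y'.
Proof.
  intros HpiG Hx. revert y x' y' p p'. revert x Hx.
  apply (HS_ind (fun x => forall y x' y' p p', HS S y ->
    set_action pi x x' -> set_action pi y y' -> ⟨p, p'⟩ ∊ pi -> feq p x y -> feq p' x' y')).
  { prove_class. }
  intros x Hx IH y x' y' p p' Hy Hxx Hyy Hpp He.
  destruct (aut_cond HpiG _ _ Hpp) as [Hp Hp'].
  assert (Hx' := HS_act _ _ _ HpiG Hx Hxx).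
  assert (Hy' := HS_act _ _ _ HpiG Hy Hyy).
  apply feq_iff in He as [H1 H2]; auto. apply feq_iff; auto. split.
  - apply (fincl_transport pi p p' x x' y y'); auto.
    intros z r u t z' u' k k' Hz Hu Hzz Huu Hkk.
    exact (IH z r Hz u z' u' k k' (HS_dom _ _ _ Hy Hu) Hzz Huu Hkk).
  - apply (fincl_transport pi p p' y y' x x'); auto.
    intros u t z r u' z' k k' Hu Hz Huu Hzz Hkk Huz.
    assert (HzS := HS_dom _ _ _ Hx Hz). assert (HuS := HS_dom _ _ _ Hy Hu).
    destruct (aut_cond HpiG _ _ Hkk) as [Hk Hk'].
    apply feq_sym; eauto using HS_act.
    apply (IH z r Hz u z' u' k k' HuS Hzz Huu Hkk). apply feq_sym; auto.
Qed.

Lemma fmem_equivariant pi p p' x x' X X' : in_G S pi -> HS S x -> HS_class_name X ->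
  action pi X X' -> set_action pi x x' -> ⟨p, p'⟩ ∊ pi -> fmem p x X -> fmem p' x' X'.
Proof.
  intros HpiG Hx HX Hact Hxx Hpp. apply (fmem_transport pi); auto.
  intros u t u' k k' Hu Huu Hkk. apply (feq_equivariant pi x u); eauto.
Qed.

Lemma fmem_set_equivariant pi p p' x x' y y' : in_G S pi -> HS S x -> HS S y ->
  set_action pi x x' -> set_action pi y y' -> ⟨p, p'⟩ ∊ pi ->
  fmem p x (of_set M y) -> fmem p' x' (of_set M y').
Proof.
  intros HpiG Hx Hy Hxx Hyy. apply fmem_equivariant; auto using HS_class_name_of_set.
  apply (action_of_set pi (aut_fun HpiG)); auto using HS_name.
Qed.

(** * Forcing for formulas *)

(** Equality of classes is forced by the clauses of the formula that defines it
    from membership, so inductions may treat it as that formula. *)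
Lemma fml_ind_core (Q : fml -> Prop) :
  (forall i j, Q (FMem i j)) -> (forall i j, Q (FEq i j)) -> (forall i k, Q (FCMem i k)) ->
  (forall phi, Q phi -> Q (FNot phi)) ->
  (forall phi psi, Q phi -> Q psi -> Q (FAnd phi psi)) ->
  (forall i phi, Q phi -> Q (FEx i phi)) ->
  (forall k l, Q (FAll 0 (FIff (FCMem 0 k) (FCMem 0 l))) -> Q (FCEq k l)) ->
  forall phi, Q phi.
Proof.
  intros Hm He Hc Hn Ha Hx Hce phi. induction phi; auto.
  apply Hce. unfold FAll, FIff, FImp. auto 10.
Qed.

Lemma fc_not_regular (F : sets M -> Prop) : regular F -> regular (fc_not S F).
Proof.
  intros [HF _]. split.
  - intros p q H Hq r Hr. exact (H r (leq_trans _ _ _ Hr Hq)).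
  - intros p Hp H q Hq HFq. destruct (H q Hq) as (r & Hr & Hn).
    apply (Hn r (leq_refl _ (leq_l _ _ Hr))). eauto.
Qed.

Lemma fc_and_regular (F1 F2 : sets M -> Prop) :
  regular F1 -> regular F2 -> regular (fc_and F1 F2).
Proof.
  intros [H1 D1] [H2 D2]. split.
  - intros p q [Ha Hb] Hq. split; eauto.
  - intros p Hp H. split; [apply D1|apply D2]; auto; intros q Hq;
      destruct (H q Hq) as (r & Hr & Ha & Hb); eauto.
Qed.

Lemma fc_ex_regular (F : sets M -> sets M -> Prop) : regular (fc_ex S F).
Proof. exact (dense_below_regular (fun r => exists z, HS S z /\ F z r)). Qed.

Lemma fc_all_intro (F : sets M -> sets M -> Prop) p :
  (forall z q, HS S z -> q ≼ p -> F z q) -> fc_all S F p.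
Proof.
  intros H q Hq Hex.
  destruct (Hex q (leq_refl _ (leq_l _ _ Hq))) as (r & Hr & z & Hz & Hn).
  apply (Hn r (leq_refl _ (leq_l _ _ Hr))).
  apply H; eauto using leq_trans.
Qed.

(** If F(z,-) failed below some q for all extensions, then q would force the
    existence of a counterexample. *)
Lemma fc_all_elim (F : sets M -> sets M -> Prop) p z : regular (F z) -> HS S z ->
  p ∊ cond S -> fc_all S F p -> F z p.
Proof.
  intros [_ HF] Hz Hp H. apply HF; [exact Hp|]. intros q Hq. apply NNPP. intros Hno.
  apply (H q Hq). intros r Hr. exists r.
  split; [exact (leq_refl _ (leq_l _ _ Hr))|].
  exists z. split; [exact Hz|]. intros s Hs HFs. apply Hno. exists s.
  eauto using leq_trans.
Qed.

Lemma fc_imp_intro (F1 F2 : sets M -> Prop) p :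
  (forall q, q ≼ p -> F1 q -> F2 q) -> fc_imp S F1 F2 p.
Proof.
  intros H q Hq [H1 Hn]. apply (Hn q (leq_refl _ (leq_l _ _ Hq))). auto.
Qed.

Lemma fc_imp_elim (F1 F2 : sets M -> Prop) p : regular F1 -> regular F2 ->
  p ∊ cond S -> fc_imp S F1 F2 p -> F1 p -> F2 p.
Proof.
  intros [HF1 _] [_ HF2] Hp H H1. apply HF2; [exact Hp|]. intros q Hq.
  apply NNPP. intros Hno. apply (H q Hq). split; [eauto|].
  intros r Hr HFr. eauto.
Qed.

Section Formulas.
Context (c : nat -> classes M) (Hc : forall n, HS_class_name (c n)).

Notation HS_env e := (forall n : nat, HS S (e n)).

Lemma HS_env_upd e n z : HS_env e -> HS S z -> HS_env (upd e n z).
Proof. intros He Hz m. unfold upd. destruct (Nat.eqb m n); auto. Qed.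

Lemma forces_in_regular x y : HS S x -> HS S y -> regular (fun p => forces_in A p x y).
Proof.
  intros Hx Hy. destruct (fmem_regular x (of_set M y)) as [H1 H2]. split.
  - intros p q H Hq. destruct (leq_cond _ _ Hq).
    apply forces_in_iff; auto. apply forces_in_iff in H; eauto.
  - intros p Hp H. apply forces_in_iff; auto. apply H2; [exact Hp|]. intros q Hq.
    destruct (H q Hq) as (r & Hr & Hin). exists r. split; [exact Hr|].
    apply forces_in_iff; eauto using leq_l.
Qed.

Lemma forces_regular phi : forall e, HS_env e -> regular (forces S A e c phi).
Proof.
  induction phi using fml_ind_core; intros e He.
  - apply forces_in_regular; apply He.
  - apply feq_regular; apply He.
  - apply fmem_regular.
  - apply fc_not_regular; auto.
  - apply fc_and_regular; auto.
  - apply fc_ex_regular.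
  - exact (IHphi e He).
Qed.

Lemma forces_congr phi : forall e e' p, HS_env e -> HS_env e' -> p ∊ cond S ->
  (forall n, feq p (e n) (e' n)) -> forces S A e c phi p -> forces S A e' c phi p.
Proof.
  induction phi using fml_ind_core; intros e e' p He He' Hp Heq H.
  - apply forces_in_iff in H; auto. apply forces_in_iff; auto.
    apply (fmem_congr_l p (e i)); auto using HS_class_name_of_set.
    apply (fmem_congr_r p (e i) (e j)); auto.
  - apply (feq_trans _ (e i)); auto; [apply feq_sym; auto|].
    apply (feq_trans _ (e j)); auto.
  - apply (fmem_congr_l p (e i)); auto.
  - intros q Hq H'. apply (H q Hq). assert (Hqc := leq_l _ _ Hq).
    apply (IHphi e'); auto. intros n. apply feq_sym; auto. apply (feq_down p); auto.
  - destruct H as [H1 H2]. split; eauto.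
  - intros q Hq. destruct (H q Hq) as (r & Hr & z & Hz & Hf).
    assert (Hrc := leq_l _ _ Hr).
    exists r. split; [exact Hr|]. exists z. split; [exact Hz|].
    apply (IHphi (upd e i z)); auto using HS_env_upd.
    intros n. unfold upd. destruct (Nat.eqb n i); [apply feq_refl; auto|].
    apply (feq_down p); eauto using leq_trans.
  - exact (IHphi e e' p He He' Hp Heq H).
Qed.

(** All automorphisms of the group H_a are treated at once, because the clause for
    negation needs the inverse. *)
Lemma forces_equivariant a : (forall pi, in_base S a pi -> forall n, action pi (c n) (c n)) ->
  forall phi pi e e' p p', in_base S a pi -> HS_env e ->
  (forall n, set_action pi (e n) (e' n)) -> ⟨p, p'⟩ ∊ pi ->
  forces S A e c phi p -> forces S A e' c phi p'.
Proof.
  intros Ha. induction phi using fml_ind_core; intros pi e e' p p' Hpi He Hee Hpp H;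
    assert (HpiG := in_base_G _ _ Hpi);
    assert (He' : HS_env e') by (intros n; exact (HS_act _ _ _ HpiG (He n) (Hee n)));
    destruct (aut_cond HpiG _ _ Hpp) as [Hp Hp'].
  - apply forces_in_iff in H; auto. apply forces_in_iff; auto.
    apply (fmem_set_equivariant pi p p' (e i) _ (e j)); auto.
  - exact (feq_equivariant pi _ _ _ _ p p' HpiG (He i) (He j) (Hee i) (Hee j) Hpp H).
  - exact (fmem_equivariant pi p p' _ _ _ _ HpiG (He i) (Hc k) (Ha pi Hpi k) (Hee i) Hpp H).
  - intros q' Hq' H'. destruct (in_base_inverse _ _ Hpi) as (tau & Hi & Htau).
    assert (HtG := in_base_G _ _ Htau).
    destruct (aut_onto HpiG q' (leq_l _ _ Hq')) as [q Hq].
    apply (H q); [apply (aut_leq HpiG _ _ _ _ Hq Hpp), Hq'|].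
    apply (IHphi tau e' e q' q Htau He'); [|apply (inverse_iff _ _ Hi), Hq|exact H'].
    intros n. exact (act_inverse _ _ _ _ HpiG HtG Hi (HS_name _ (He n)) (Hee n)).
  - destruct H as [H1 H2]. split; eauto.
  - intros q' Hq'. destruct (aut_onto HpiG q' (leq_l _ _ Hq')) as [q Hq].
    destruct (H q) as (r & Hr & z & Hz & Hf).
    { apply (aut_leq HpiG _ _ _ _ Hq Hpp), Hq'. }
    destruct (aut_total HpiG r (leq_l _ _ Hr)) as [r' Hr'].
    destruct (act_total HpiG z (HS_name _ Hz)) as [z' Hz'].
    exists r'. split; [apply (aut_leq HpiG _ _ _ _ Hr' Hq), Hr|].
    exists z'. split; [exact (HS_act _ _ _ HpiG Hz Hz')|].
    apply (IHphi pi (upd e i z) (upd e' i z') r r' Hpi); auto using HS_env_upd.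
    intros n. unfold upd. destruct (Nat.eqb n i); auto.
  - exact (IHphi pi e e' p p' Hpi He Hee Hpp H).
Qed.

(** Makes forced properties available to Collection and [predense_decision]; the
    condition is variable 0, and the variables of [phi] are shifted by one. *)
Lemma forces_definable phi :
  definable (fun e => forces S A (fun n => e (Datatypes.S n)) c phi (e 0)).
Proof.
  induction phi using fml_ind_core; cbn [forces].
  - prove_definable.
  - prove_definable.
  - prove_definable.
  - unfold fc_not. apply (definable_all (fun e q => leq S q (e 0) ->
      ~ forces S A (fun n => e (Datatypes.S n)) c phi q)).
    apply definable_imp; [prove_definable|]. apply definable_not.
    exact (definable_rename _
      (fun n => match n with 0 => 0 | Datatypes.S m => 2 + m end) IHphi).
  - apply definable_and; assumption.
  - unfold fc_ex.
    apply (definable_all (fun e q => leq S q (e 0) -> exists r, leq S r q /\ exists z, HS S z /\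
      forces S A (upd (fun n => e (Datatypes.S n)) i z) c phi r)).
    apply definable_imp; [prove_definable|].
    apply (definable_ex (fun e r => leq S r (e 0) /\ exists z, HS S z /\
      forces S A (upd (fun n => e (2 + n)) i z) c phi r)).
    apply definable_and; [prove_definable|].
    apply (definable_ex (fun e z => HS S z /\
      forces S A (upd (fun n => e (3 + n)) i z) c phi (e 0))).
    apply definable_and; [prove_definable|].
    refine (definable_equiv _ _ _ (definable_rename _ (fun n => match n with 0 => 1
      | Datatypes.S m => if Nat.eqb m i then 0 else 4 + m end) IHphi)).
    intros e. simpl.
    match goal with |- forces _ _ ?f _ _ _ <-> forces _ _ ?g _ _ _ => replace f with g end.
    { reflexivity. }
    apply functional_extensionality. intros n. unfold upd.
    destruct (Nat.eqb n i); reflexivity.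
  - exact IHphi.
Qed.

End Formulas.

(** * Preservation of Separation and Collection *)

Section Preservation.
Context (Hpre : combinatorially_pretame S) (Hstr : stratified S).
Context (Gamma : classes M) (HGamma : is_class_S_name S Gamma).

Lemma Gamma_HS : HS_class_name Gamma.
Proof. exact (proj2 HGamma). Qed.

Lemma common_base x : HS S x -> exists a, in_dom (CF S) a /\
  forall pi, in_base S a pi -> action pi Gamma Gamma /\ set_action pi x x.
Proof.
  intros Hx. destruct HGamma as [[HGn HGsym] _].
  apply (sym_in_F Gamma HGn) in HGsym as (a & Ha & HaG).
  destruct (HS_fixed x Hx) as (b & Hb & Hbx).
  destruct (css_directed hS Ha Hb) as (c & Hc & Hcab). exists c. split; [exact Hc|].
  intros pi Hpi. destruct (Hcab pi Hpi). auto.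
Qed.

(** The conditions put into y are those of the symmetric set b, not only those
    supplied by [predense_decision]; this is what makes y symmetric. *)
Lemma separation_witness x p : HS S x -> p ∊ cond S ->
  exists q y, q ≼ p /\ HS S y /\ forall z r, HS S z -> r ≼ q ->
    (fmem r z (of_set M y) <-> fmem r z (of_set M x) /\ fmem r z Gamma).
Proof.
  intros Hx Hp. destruct (common_base x Hx) as (a & Ha & Hfix).
  set (G := fun w d => d ∊ cond S /\ fmem d w (of_set M x) /\ fmem d w Gamma).
  assert (HG : class_rel G) by (unfold G; prove_class).
  assert (Hinv : invariant a G).
  { intros pi w w' d d' Hpi Hw Hww Hdd (Hd & H1 & H2). destruct (Hfix pi Hpi) as [HpG Hpx].
    assert (HpiG := in_base_G _ _ Hpi). split; [apply (aut_cond HpiG _ _ Hdd)|].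
    split; [exact (fmem_set_equivariant pi d d' w w' x x HpiG Hw Hx Hww Hpx Hdd H1)|].
    exact (fmem_equivariant pi d d' w w' Gamma Gamma HpiG Hw Gamma_HS HpG Hww Hdd H2). }
  destruct (predense_decision Hpre x p a G Hx Hp Ha HG) as (q & e & Hq & He & Hdec).
  { intros w d d' (Hd & H1 & H2) Hd'. split; [exact (leq_l _ _ Hd')|].
    split; eapply fmem_down; eauto. }
  { exact Hinv. }
  destruct (range e) as [c0 Hc0].
  destruct (Hstr c0) as (b & Hbc & Hbsym & Hcb).
  { intros d Hd. apply Hc0 in Hd as [w Hw]. apply (He w d Hw). }
  destruct (symmetric_set_base b Hbsym) as (a' & Ha' & Hab).
  destruct (css_directed hS Ha Ha') as (a2 & Ha2 & Hsub).
  destruct (domain x) as [i Hi]. destruct (product i b) as [ib Hib].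
  destruct (bounded_set (fun v => exists w d, w ∈ i /\ d ∈ b /\ G w d /\ v = ⟨w, d⟩) ib)
    as [y Hy]. { prove_class. }
  { intros v (w & d & Hw & Hd & _ & ->). apply Hib. eauto. }
  assert (Hyp : forall w d, ⟨w, d⟩ ∈ y <-> w ∈ i /\ d ∈ b /\ G w d).
  { intros w d. rewrite Hy. split; [|intros (H1 & H2 & H3); exists w, d; auto].
    intros (w' & d' & H1 & H2 & H3 & E). apply (opair_inj) in E as [-> ->]. auto. }
  assert (HiS : forall w, w ∈ i -> HS S w).
  { intros w Hw. apply Hi in Hw as [t Ht]. exact (HS_dom _ _ _ Hx Ht). }
  assert (HyS : HS S y).
  { assert (Hyn : forall w, w ∈ y -> exists y p, w = ⟨y, p⟩ /\ HS S y /\ p ∊ cond S).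
    { intros v Hv. apply Hy in Hv as (w & d & Hw & Hd & _ & ->). exists w, d. auto. }
    apply (HS_intro _ Hyn). apply (fixed_set_intro y a2); [|exact Ha2|].
    - apply (name_intro). intros v Hv. destruct (Hyn v Hv) as (w & d & -> & Hw & Hd).
      exists w, d. split; [reflexivity|]. split; [exact (HS_name _ Hw)|exact Hd].
    - intros pi w w' d d' Hpi Hwd Hww Hdd. apply Hyp in Hwd as (Hw & Hd & HGwd).
      destruct (Hsub pi Hpi) as [Hpi1 Hpi2]. destruct (Hfix pi Hpi1) as [_ Hpx].
      assert (HpiG := in_base_G _ _ Hpi).
      apply Hyp. split; [|split; [|exact (Hinv pi w w' d d' Hpi1 (HiS w Hw) Hww Hdd HGwd)]].
      + apply Hi in Hw as [t Ht].
        destruct (aut_total HpiG t (HS_cond _ _ _ Hx Ht)) as [t' Ht'].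
        apply Hi. exists t'. exact (act_member _ _ _ _ _ _ Hpx Ht Hww Ht').
      + apply (gb_of_set HGB), (Hab pi Hpi2). exists d.
        split; [apply (gb_of_set HGB), Hd|exact Hdd]. }
  exists q, y. split; [exact Hq|]. split; [exact HyS|]. intros z r Hz Hr. split.
  - intros H. assert (HX := HS_class_name_of_set x Hx).
    assert (D : dense_below S (fun r => fmem r z (of_set M x) /\ fmem r z Gamma) r).
    { intros r0 Hr0. destruct (H r0 Hr0) as (r1 & Hr1 & w & t & Hw & Ht & Hzw).
      exists r1. split; [exact Hr1|]. assert (Hr1c := leq_l _ _ Hr1).
      apply (gb_of_set HGB), Hyp in Hw as (Hw & _ & _ & H1 & H2).
      assert (HwS := HiS w Hw).
      assert (Hwz : feq r1 w z) by (apply feq_sym; auto).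
      split; apply (fmem_congr_l r1 w); auto using Gamma_HS; eapply fmem_down; eauto. }
    assert (Hrc := leq_l _ _ Hr).
    split; (apply fmem_regular; [exact Hrc|]); intros r0 Hr0;
      destruct (D r0 Hr0) as (r1 & Hr1 & H1 & H2); eauto.
  - intros [H1 H2]. apply fmem_regular; [exact (leq_l _ _ Hr)|]. intros r0 Hr0.
    destruct (H1 r0 Hr0) as (r1 & Hr1 & w & t & Hw & Ht & Hzw).
    apply (gb_of_set HGB) in Hw. assert (Hr1c := leq_l _ _ Hr1).
    assert (Hr1r := leq_trans _ _ _ Hr1 Hr0).
    assert (HwS := HS_dom _ _ _ Hx Hw).
    destruct (Hdec w t r1 Hw (leq_trans _ _ _ Hr1r Hr)) as (d & Hd & r2 & Hr2c & Hr2 & Hr2d).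
    { split; [exact Hr1c|]. split; apply (fmem_congr_l r1 z); auto using Gamma_HS,
        HS_class_name_of_set; eapply fmem_down; eauto. }
    exists r2. split; [exact (leq_trans _ _ _ Hr2 Hr1)|].
    apply (fmem_intro r2 z w d); auto.
    + apply (gb_of_set HGB), Hyp. split; [apply Hi; eauto|].
      split; [apply Hcb, Hc0; eauto|exact (proj2 (He w d Hd))].
    + apply (feq_down r1); auto.
Qed.

(** The environment gives w to every variable except v, although only the variables
    2 and 3 are free in the formula: an automorphism sends an environment determined by
    w and v to the one determined by their images. *)
Definition pair_forced (w v d : sets M) : Prop :=
  forces S A (fun n => if Nat.eqb n 3 then v else w) (fun _ => Gamma) (f_opair_in 2 3 0) d.

Lemma pair_env w v : HS S w -> HS S v -> forall n, HS S (if Nat.eqb n 3 then v else w).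
Proof. intros Hw Hv n. destruct (Nat.eqb n 3); assumption. Qed.

Lemma pair_forced_regular w v : HS S w -> HS S v -> regular (pair_forced w v).
Proof. intros Hw Hv. apply forces_regular, pair_env; assumption. Qed.

Lemma pair_forced_class : class_rel3 pair_forced.
Proof.
  apply class_rel3_intro.
  refine (definable_equiv _ _ _ (definable_rename _ (fun n => match n with 0 => 2
    | Datatypes.S m => if Nat.eqb m 3 then 1 else 0 end)
    (forces_definable (fun _ => Gamma) (f_opair_in 2 3 0)))).
  intros e. unfold pair_forced.
  match goal with |- forces _ _ ?f _ _ _ <-> forces _ _ ?g _ _ _ => replace f with g end.
  { reflexivity. }
  apply functional_extensionality. intros n. destruct (Nat.eqb n 3); reflexivity.
Qed.
Hint Resolve pair_forced_class : gb_class.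

Lemma pair_forced_congr w w' v p : HS S w -> HS S w' -> HS S v -> p ∊ cond S ->
  feq p w w' -> pair_forced w v p -> pair_forced w' v p.
Proof.
  intros Hw Hw' Hv Hp He. apply forces_congr; auto using pair_env, Gamma_HS.
  intros n. destruct (Nat.eqb n 3); [apply feq_refl; auto|exact He].
Qed.

Lemma pair_forced_equivariant a pi w v w' v' p p' :
  (forall pi, in_base S a pi -> action pi Gamma Gamma) -> in_base S a pi ->
  HS S w -> HS S v -> set_action pi w w' -> set_action pi v v' -> ⟨p, p'⟩ ∊ pi ->
  pair_forced w v p -> pair_forced w' v' p'.
Proof.
  intros Ha Hpi Hw Hv Hww Hvv Hpp.
  apply (forces_equivariant (fun _ => Gamma) (fun _ => Gamma_HS) a (fun pi H _ => Ha pi H)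
    (f_opair_in 2 3 0) pi); auto using pair_env.
  intros n. destruct (Nat.eqb n 3); assumption.
Qed.

(** A condition forcing u = w and <u,v> in Gamma also forces <w,v> in Gamma, hence is
    compatible with a condition d supplied by [predense_decision]; the witness
    collected for d and w then serves for u below both. *)
Lemma collection_witness x p : HS S x -> p ∊ cond S ->
  (forall u r, HS S u -> r ≼ p -> fmem r u (of_set M x) ->
    fc_ex S (fun v => pair_forced u v) r) ->
  exists q y, q ≼ p /\ HS S y /\ forall u r, HS S u -> r ≼ q -> fmem r u (of_set M x) ->
    fc_ex S (fun v => fc_and (fun s => forces_in A s v y) (pair_forced u v)) r.
Proof.
  intros Hx Hp Hfun. destruct (common_base x Hx) as (a & Ha & Hfix).
  set (G := fun w d => HS S w /\ exists v, HS S v /\ pair_forced w v d).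
  destruct (predense_decision Hpre x p a G Hx Hp Ha) as (q & e & Hq & He & Hdec).
  { unfold G. prove_class. }
  { intros w d d' (Hw & v & Hv & H) Hd. split; [exact Hw|]. exists v. split; [exact Hv|].
    exact (proj1 (pair_forced_regular w v Hw Hv) d d' H Hd). }
  { intros pi w w' d d' Hpi _ Hww Hdd (Hw & v & Hv & H).
    assert (HpiG := in_base_G _ _ Hpi).
    destruct (act_total HpiG v (HS_name _ Hv)) as [v' Hv'].
    split; [exact (HS_act _ _ _ HpiG Hw Hww)|].
    exists v'. split; [exact (HS_act _ _ _ HpiG Hv Hv')|].
    apply (pair_forced_equivariant a pi w v w' v' d d'); auto. intros pi' H'. apply (Hfix pi' H'). }
  destruct (collection (fun j v => HS S v /\ exists w d, j = ⟨w, d⟩ /\ pair_forced w v d) e)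
    as [b Hb]. { prove_class. }
  destruct (separation (HS S) b) as [b' Hb']. { prove_class. }
  destruct (HS_cover Hstr b') as (y & Hy & Hby).
  { intros v Hv. apply Hb', Hv. }
  exists q, y. split; [exact Hq|]. split; [exact Hy|]. intros u r Hu Hr Hux r0 Hr0.
  destruct (Hux r0 Hr0) as (r1 & Hr1 & w & t & Hw & Ht & Huw).
  apply (gb_of_set HGB) in Hw. assert (HwS := HS_dom _ _ _ Hx Hw).
  assert (Hr1r := leq_trans _ _ _ Hr1 Hr0).
  assert (Hr1q := leq_trans _ _ _ Hr1r Hr).
  destruct (Hfun u r1 Hu (leq_trans _ _ _ Hr1q Hq) (fmem_down _ _ _ _ Hux Hr1r)
    r1 (leq_refl _ (leq_l _ _ Hr1))) as (r2 & Hr2 & v & Hv & Huv).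
  assert (Hr2c := leq_l _ _ Hr2).
  destruct (Hdec w t r2 Hw (leq_trans _ _ _ Hr2 Hr1q)) as (d & Hd & r3 & Hr3c & Hr3 & Hr3d).
  { split; [exact HwS|]. exists v. split; [exact Hv|].
    apply (pair_forced_congr u w v r2); auto. apply (feq_down r1); auto. }
  destruct (He w d Hd) as (_ & _ & v0 & Hv0 & Hwv0).
  destruct (Hb _ Hd) as (v1 & Hv1b & Hv1 & w1 & d1 & E & Hwv1).
  { exists v0. split; [exact Hv0|]. exists w, d. auto. }
  apply (opair_inj) in E as [<- <-].
  exists r3. split; [exact (leq_trans _ _ _ Hr3 (leq_trans _ _ _ Hr2 Hr1))|].
  exists v1. split; [exact Hv1|]. split.
  - apply forces_in_iff; auto. apply (fmem_intro r3 v1 v1 (one S)); auto.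
    + apply (gb_of_set HGB), Hby, Hb'. auto.
    + exact (leq_one _ Hr3c).
    + apply feq_refl; auto.
  - apply (pair_forced_congr w u v1 r3); auto.
    + apply feq_sym; auto. apply (feq_down r1); auto.
      exact (leq_trans _ _ _ Hr3 Hr2).
    + exact (proj1 (pair_forced_regular w v1 HwS Hv1) d r3 Hwv1 Hr3d).
Qed.

Lemma separation_forced e : forces S A e (fun _ => Gamma) f_separation (one S).
Proof.
  (* The forcing clauses of the formula, with the environment evaluated. *)
  change (fc_all S (fun x => fc_ex S (fun y => fc_all S (fun z =>
    fc_iff S (fun p => forces_in A p z y)
      (fc_and (fun p => forces_in A p z x) (forces_cmem S A z Gamma))))) (one S)).
  apply fc_all_intro. intros x q0 Hx Hq0 q Hq.
  destruct (separation_witness x q Hx (leq_l _ _ Hq)) as (r & y & Hr & Hy & H).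
  exists r. split; [exact Hr|]. exists y. split; [exact Hy|].
  apply fc_all_intro. intros z s Hz Hs.
  split; apply fc_imp_intro; intros t Ht; assert (Htc := leq_l _ _ Ht);
    assert (Htr := leq_trans _ _ _ Ht Hs); unfold fc_and;
    rewrite !forces_in_iff by assumption; apply H; assumption.
Qed.

Lemma collection_forced e : forces S A e (fun _ => Gamma) f_collection (one S).
Proof.
  change (fc_all S (fun x => fc_imp S
    (fc_and (forces S A (upd e 0 x) (fun _ => Gamma) f_is_relation)
      (fc_all S (fun u => fc_imp S (fun p => forces_in A p u x)
        (fc_ex S (fun v => pair_forced u v)))))
    (fc_ex S (fun y => fc_all S (fun u => fc_imp S (fun p => forces_in A p u x)
      (fc_ex S (fun v => fc_and (fun s => forces_in A s v y) (pair_forced u v)))))))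
    (one S)).
  apply fc_all_intro. intros x p0 Hx Hp0. apply fc_imp_intro. intros p1 Hp1 [_ Hfun] p Hp.
  assert (Hpc := leq_l _ _ Hp).
  destruct (collection_witness x p Hx Hpc) as (q & y & Hq & Hy & H).
  { intros u r Hu Hr Hux. assert (Hrc := leq_l _ _ Hr).
    apply (fc_imp_elim (fun p => forces_in A p u x)).
    - apply forces_in_regular; assumption.
    - apply fc_ex_regular.
    - exact Hrc.
    - apply (fc_all_elim (fun u => fc_imp S (fun p => forces_in A p u x)
        (fc_ex S (fun v => pair_forced u v))) r u); auto.
      + apply fc_not_regular, fc_and_regular; [apply forces_in_regular; assumption|].
        apply fc_not_regular, fc_ex_regular.
      + intros r' Hr'. apply Hfun. eauto using leq_trans.
    - apply forces_in_iff; assumption. }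
  exists q. split; [exact Hq|]. exists y. split; [exact Hy|].
  apply fc_all_intro. intros u s Hu Hs. apply fc_imp_intro. intros t Ht Hux.
  apply H; [exact Hu|exact (leq_trans _ _ _ Ht Hs)|].
  apply forces_in_iff; eauto using leq_l.
Qed.

End Preservation.

End ClassForcing.

Theorem theorem32 (M : structure) (HGB : GB M) (S : system_data M)
    (hS : class_symmetric_system S) :
  combinatorially_pretame S -> stratified S -> pretame S.
Proof.
  intros Hpre Hstr. split; [exact (forcing_relation_exists HGB S hS Hpre)|].
  intros A HA Gamma e HGamma _.
  split; [exact (separation_forced HGB S hS A HA Hpre Hstr Gamma HGamma e)|].
  exact (collection_forced HGB S hS A HA Hpre Hstr Gamma HGamma e).
Qed.
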